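(* Let $(\mathcal{R},\le,r)$ be a topological Ramsey space and let $E$ be a countable Borel equivalence relation on $\mathcal{R}$ (with respect to the metric topology of $\mathcal{R}$). Then there is $A\in\mathcal{R}$ such that the restriction of $E$ to $[A]=\{B\in\mathcal{R}: B\le A\}$ is hyperfinite.
   Context: **Topological Ramsey spaces (in the sense of Todorčević).** A topological Ramsey space is a triple $(\mathcal{R},\le,r)$, where $\mathcal{R}$ is a nonempty set, $\le$ is a quasi-ordering on $\mathcal{R}$, and $r:\mathcal{R}\times\mathbb{N}\to\mathcal{AR}$ is a function; write $r_n(A)=r(A,n)$, $\mathcal{AR}_n=\{r_n(A):A\in\mathcal{R}\}$ and $\mathcal{AR}=\bigcup_n\mathcal{AR}_n$ (the set of finite approximations). The following are required. (A.1) (a) $r_0(A)=\emptyset$ for all $A\in\mathcal{R}$; (b) $A\neq B$ implies $r_n(A)\ne r_n(B)$ for some $n$; (c) $r_n(A)=r_m(B)$ implies $n=m$ and $r_k(A)=r_k(B)$ for all $k<n$. By (A.1), each $a\in\mathcal{AR}$ has a well-defined length $|a|$, the unique $n$ with $a\in\mathcal{AR}_n$; write $a\sqsubseteq b$ if there are $A\in\mathcal{R}$ and $m\le n$ with $a=r_m(A)$, $b=r_n(A)$. (A.2) There is a quasi-ordering $\le_{\mathrm{fin}}$ on $\mathcal{AR}$ such that: (a) $\{a\in\mathcal{AR}:a\le_{\mathrm{fin}}b\}$ is finite for every $b\in\mathcal{AR}$; (b) $A\le B$ iff for every $n$ there is $m$ with $r_n(A)\le_{\mathrm{fin}}r_m(B)$;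 (c) if $a\sqsubseteq b$ and $b\le_{\mathrm{fin}}c$, then there is $d\sqsubseteq c$ with $a\le_{\mathrm{fin}}d$. For $a\in\mathcal{AR}$, $B\in\mathcal{R}$, $n\in\mathbb{N}$ let $[a,B]=\{A\in\mathcal{R}:A\le B\wedge(\exists n)\,r_n(A)=a\}$, $[n,B]=[r_n(B),B]$, $[B]=\{A\in\mathcal{R}:A\le B\}$. Let $\mathrm{depth}_B(a)=\min\{n:a\le_{\mathrm{fin}}r_n(B)\}$ if such $n$ exists and $\infty$ otherwise. (A.3) (a) If $\mathrm{depth}_B(a)<\infty$ then $[a,A]\neq\emptyset$ for all $A\in[\mathrm{depth}_B(a),B]$; (b) if $A\le B$ and $[a,A]\ne\emptyset$, then there is $A'\in[\mathrm{depth}_B(a),B]$ with $\emptyset\ne[a,A']\subseteq[a,A]$. (A.4) If $\mathrm{depth}_B(a)<\infty$ and $\mathcal{O}\subseteq\mathcal{AR}_{|a|+1}$, then there is $A\in[\mathrm{depth}_B(a),B]$ such that $\{r_{|a|+1}(C):C\in[a,A]\}$ is either contained in $\mathcal{O}$ or disjoint from $\mathcal{O}$. Identify $A\in\mathcal{R}$ with the sequence $(r_n(A))_{n\in\mathbb{N}}\in\mathcal{AR}^{\mathbb{N}}$, where $\mathcal{AR}$ is discrete and $\mathcal{AR}^{\mathbb{N}}$ has the product topology. The induced topology on $\mathcal{R}$ is called the metric topology. It is assumed that $\mathcal{R}$ is a closed subset of $\mathcal{AR}^{\mathbb{N}}$ and that $\mathcal{R}$ is Polish in the metric topology (equivalently,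 $\mathcal{AR}$ is countable). All Borel notions on $\mathcal{R}$ refer to the metric topology. **Equivalence relations.** A countable Borel equivalence relation (CBER) on a Polish (or standard Borel) space $X$ is an equivalence relation on $X$ that is Borel as a subset of $X^2$ and has all classes countable. For $E$ on $X$ and $F$ on $Y$, a Borel reduction of $E$ to $F$ is a Borel map $\phi:X\to Y$ with $x\,E\,x'\iff\phi(x)\,F\,\phi(x')$ for all $x,x'\in X$. A CBER is hyperfinite if it admits a Borel reduction to $\mathbb{E}_0$, the relation of eventual equality on $2^{\mathbb{N}}$. The restriction of $E$ to a Borel set $Y\subseteq X$ is $E\cap Y^2$, a CBER on $Y$. *)

(* Defs.v *)
From HB Require Import structures.
From mathcomp Require Import all_boot all_order all_algebra.
From mathcomp Require Import all_classical all_reals.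
From mathcomp Require Import topology measurable_structure cantor.
From Stdlib Require Import RelationClasses.

Set Implicit Arguments.
Unset Strict Implicit.
Unset Printing Implicit Defensive.

Import Order.TTheory GRing.Theory Num.Theory.
Local Open Scope classical_set_scope.
Local Open Scope ring_scope.

(* The quasi-ordering [lefin] is part of the structure, although (A.2) only
   asserts that one exists, because depth, (A.3) and (A.4) depend on it. *)
Record approxSpace := ApproxSpace {
  carrier :> choiceType;
  approx : choiceType;
  leR : carrier -> carrier -> Prop;
  r : carrier -> nat -> approx;
  lefin : approx -> approx -> Prop;
  empty_approx : approx }.

Arguments leR {_} A B.
Arguments r {_} A n.
Arguments lefin {_} a b.
Arguments empty_approx {_}.

Section RamseyDefinitions.
Variable R : approxSpace.
Local Notation AR := (approx R).
Implicit Types (A B : R) (a b : AR) (n : nat).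

Definition AR_ n : set AR := [set r A n | A in [set: R]].

Definition initial_segment a b : Prop :=
  exists A m n, [/\ (m <= n)%N, a = r A m & b = r A n].

(* [a, B] *)
Definition basic a B : set R := [set A | leR A B /\ exists n, r A n = a].

(* [n, B] *)
Definition basic_nat n B : set R := basic (r B n) B.

(* [B] *)
Definition below B : set R := [set A | leR A B].

(* [depth_is B a n] means that depth_B(a) is finite and equal to n. *)
Definition depth_is B a n : Prop :=
  lefin a (r B n) /\ forall m, lefin a (r B m) -> (n <= m)%N.

(* [AR_ n a] plays the role of |a| = n; (A.1)(c) makes n unique, and
   [ramsey_approx] makes it exist. *)
Record topological_ramsey : Prop := TopologicalRamsey {
  ramsey_nonempty : [set: R] !=set0;
  ramsey_le : PreOrder (@leR R);
  ramsey_approx : forall a, exists n, AR_ n a;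
  ramsey_A1a : forall A, r A 0 = empty_approx;
  ramsey_A1b : forall A B, A <> B -> exists n, r A n <> r B n;
  ramsey_A1c : forall A B n m, r A n = r B m ->
    n = m /\ forall k, (k < n)%N -> r A k = r B k;
  ramsey_A2 : PreOrder (@lefin R);
  ramsey_A2a : forall b, finite_set [set a | lefin a b];
  ramsey_A2b : forall A B,
    leR A B <-> forall n, exists m, lefin (r A n) (r B m);
  ramsey_A2c : forall a b c, initial_segment a b -> lefin b c ->
    exists2 d, initial_segment d c & lefin a d;
  ramsey_A3a : forall B a n, depth_is B a n ->
    forall A, basic_nat n B A -> basic a A !=set0;
  ramsey_A3b : forall A B a, leR A B -> basic a A !=set0 ->
    exists n, depth_is B a n /\
      exists2 A', basic_nat n B A' &
        basic a A' !=set0 /\ basic a A' `<=` basic a A;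
  ramsey_A4 : forall B a n k (O : set AR),
    depth_is B a n -> AR_ k a -> O `<=` AR_ k.+1 ->
    exists2 A, basic_nat n B A &
      [set r C k.+1 | C in basic a A] `<=` O \/
      [set r C k.+1 | C in basic a A] `&` O = set0 }.

Definition approx_seq (A : R) :
  prod_topology (fun _ : nat => discrete_topology AR) := r A.

Definition metric_topology : topologicalType := initial_topology approx_seq.

End RamseyDefinitions.

Definition polish (K : realType) (T : topologicalType) : Prop :=
  (exists2 D : set T, countable D & dense D) /\
  exists d : T -> T -> K,
    [/\ forall x y, d x y = 0 <-> x = y,
        forall x y, d x y = d y x,
        forall x y z, d x z <= d x y + d y z,
        forall x (U : set T),
          nbhs x U <-> exists2 e, 0 < e & [set y | d x y < e] `<=` U &
        forall u : nat -> T,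
          (forall e, 0 < e -> exists N, forall m n,
             (N <= m)%N -> (N <= n)%N -> d (u m) (u n) < e) ->
          exists l : T, u n @[n --> \oo] --> l].

Definition borel (T : topologicalType) : set (set T) := <<s @open T >>.

Definition borel_map (X Y : topologicalType) (f : X -> Y) : Prop :=
  forall U : set Y, borel U -> borel (f @^-1` U).

Definition cber (X : topologicalType) (E : X -> X -> Prop) : Prop :=
  [/\ Equivalence E,
      borel [set p : X * X | E p.1 p.2] &
      forall x, countable [set y | E x y]].

Definition borel_reduction (X Y : topologicalType) (E : X -> X -> Prop)
    (F : Y -> Y -> Prop) (phi : X -> Y) : Prop :=
  borel_map phi /\ forall x x', E x x' <-> F (phi x) (phi x').

Definition E0 (x y : cantor_space) : Prop :=
  exists N : nat, forall n, (N <= n)%N -> x n = y n.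

Definition hyperfinite (X : topologicalType) (E : X -> X -> Prop) : Prop :=
  exists phi : X -> cantor_space, borel_reduction E E0 phi.

(* The type [Y] carries the subspace topology, so that its Borel sets are the
   traces on [Y] of the Borel sets of [X]. *)
Definition restriction (X : topologicalType) (E : X -> X -> Prop) (Y : set X) :
  Y -> Y -> Prop := fun x y => E (\val x) (\val y).

Arguments restriction {X} E Y x y.

(* Main.v *)
(** Shrinking A repeatedly, a fusion argument makes every one of countably many
    sigma-ideals decided on all sets [a, A]. Applied to the ideals of sets over which
    a piece of E is covered by countably many continuous partial functions, this gives
    an A on which all of E is so covered, since otherwise some X would have a perfect
    set of E-related points. Hence E on [A] is an increasing union of locally finite
    graphs G_n. Given finitely many such functions and some a of depth n in A, A can be
    shrunk inside [n, A] so that no two distinct elements of [a, A] are related by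
    them: the first approximations at which two related points differ determine one
    another, and a 2-colouring of them is homogenized by (A.4). Do this for all G_n-paths
    up to a length L_n that depends only on r_0(A), ..., r_n(A). The points having an
    approximation of depth n then form a set U_n on which long-range G_n-components
    have at most as many elements as there are such approximations. As every point
    lies in infinitely many U_n, the relations F_(n+1) generated by F_n and the
    G_n-edges meeting U_n are finite and exhaust E on [A]. An increasing union of
    finite Borel equivalence relations is reduced to E_0 by recording, for each n, the
    F_n-class inside its F_(n+1)-class and the finite trace of the F_n-class on the
    first n approximations. *)

Require Import Defs.
From mathcomp Require Import all_boot all_order all_algebra.
From mathcomp Require Import all_classical all_reals.
From mathcomp Require Import topology measurable_structure cantor.
From Stdlib Require Import RelationClasses.

Set Implicit Arguments.
Unset Strict Implicit.
Unset Printing Implicit Defensive.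

Local Open Scope classical_set_scope.

(** * Approximations, depth and fusion *)

Lemma least_nat (P : nat -> Prop) :
  (exists n, P n) -> exists2 n, P n & forall m, P m -> n <= m.
Proof.
move=> exP; have exb : exists n, `[< P n >] by case: exP => n /asboolP; exists n.
case: (ex_minnP exb) => n /asboolP Pn min_n; exists n => // m /asboolP.
exact: min_n.
Qed.

Lemma dependent_choice_nat (T : Type) (Q : T -> Prop) (S : nat -> T -> T -> Prop)
    (x0 : T) :
  Q x0 -> (forall n x, Q x -> exists2 y, Q y & S n x y) ->
  exists u : nat -> T, [/\ u 0 = x0, forall n, Q (u n) &
    forall n, S n (u n) (u n.+1)].
Proof.
move=> Qx0 step.
have next (p : nat * {x | Q x}) : {y : {x | Q x} | S p.1 (sval p.2) (sval y)}.
  case: p => n [x Qx] /=; apply: cid.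
  by have [y Qy Sxy] := step n x Qx; exists (exist _ y Qy).
pose v := fix v n : {x | Q x} :=
  if n is m.+1 then sval (next (m, v m)) else exist _ x0 Qx0.
exists (fun n => sval (v n)); split=> [//|n|n]; first exact: svalP.
exact: (svalP (next (n, v n))).
Qed.

(** Otherwise points outside [U] agree with [x] on longer and longer initial segments; each
    coordinate is eventually constant, so they converge to [x]. *)
Lemma nbhs_prod_nat (K : nat -> topologicalType) (x : prod_topology K) U :
  nbhs x U -> exists n, forall y : prod_topology K,
    (forall k, k <= n -> y k = x k) -> U y.
Proof.
move=> nU; apply: contrapT => /forallNP far.
have {far} /choice[y yP] n : exists y : prod_topology K,
    (forall k, k <= n -> y k = x k) /\ ~ U y.
  have /existsNP[y /not_implyP[]] := far n; by exists y.
have : y @ \oo --> x.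
  apply/cvg_sup => i V [W [[V' oV' <-] Vx] WV]; apply: filterS WV _.
  by rewrite nbhs_simpl; exists i => // n lein /=; rewrite (yP n).1.
move=> /(_ U nU)[n _ /(_ n)]; rewrite /= leqnn => /(_ isT); exact: (yP n).2.
Qed.

Section Basics.
Variable R : approxSpace.
Hypothesis ramseyR : topological_ramsey R.
Local Notation AR := (approx R).
Implicit Types (A B C X Y : R) (a b c : AR) (n m k : nat).

Lemma r_len X Y n m : r X n = r Y m -> n = m.
Proof. by case/(ramsey_A1c ramseyR). Qed.

Lemma r_prefix X Y n k : r X n = r Y n -> k <= n -> r X k = r Y k.
Proof.
move=> eXY; rewrite leq_eqVlt => /predU1P[->//|ltkn].
by have [_ /(_ k ltkn)] := ramsey_A1c ramseyR eXY.
Qed.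

Lemma r_inj X Y : (forall n, r X n = r Y n) -> X = Y.
Proof.
move=> eXY; apply: contrapT => /(ramsey_A1b ramseyR)[n]; exact.
Qed.

Lemma r_sep X Y : X <> Y -> exists n, forall m, n <= m -> r X m <> r Y m.
Proof.
move=> /(ramsey_A1b ramseyR)[n neq]; exists n => m lenm /r_prefix/(_ lenm).
exact: neq.
Qed.

Lemma leR_refl A : leR A A.
Proof. by have [refl _] := ramsey_le ramseyR; apply: refl. Qed.

Lemma leR_trans A B C : leR A B -> leR B C -> leR A C.
Proof. by have [_ trans] := ramsey_le ramseyR; apply: trans. Qed.

Definition len a : nat := projT1 (cid (ramsey_approx ramseyR a)).

Lemma len_r X n : len (r X n) = n.
Proof.
rewrite /len; case: cid => m [Y _ eYX] /=.
exact: (r_len eYX).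
Qed.

Lemma basicP a A X : basic a A X <-> leR X A /\ r X (len a) = a.
Proof.
split=> [[leXA [n <-]]|[leXA eXa]]; last by split=> //; exists (len a).
by rewrite len_r.
Qed.

Lemma basic_rP Y k A X : basic (r Y k) A X <-> leR X A /\ r X k = r Y k.
Proof. by rewrite basicP len_r. Qed.

Lemma basic_natP n B A : basic_nat n B A <-> leR A B /\ r A n = r B n.
Proof. exact: basic_rP. Qed.

Lemma basic_nat_refl n A : basic_nat n A A.
Proof. by apply/basic_natP; split=> //; apply: leR_refl. Qed.

Lemma basic_nat_trans n A B C : basic_nat n A B -> basic_nat n B C -> basic_nat n A C.
Proof.
move=> /basic_natP[leBA eBA] /basic_natP[leCB eCB]; apply/basic_natP.
by split; [exact: leR_trans leCB leBA | rewrite eCB].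
Qed.

Lemma basic_nat_le n m A B : n <= m -> basic_nat m A B -> basic_nat n A B.
Proof.
move=> lenm /basic_natP[leBA eBA]; apply/basic_natP; split=> //.
exact: r_prefix eBA lenm.
Qed.

Lemma basic_sub a A B : leR A B -> basic a A `<=` basic a B.
Proof. by move=> leAB X [leXA ?]; split=> //; apply: leR_trans leXA leAB. Qed.

Lemma depth_exists A X k : leR X A -> exists n, depth_is A (r X k) n.
Proof.
move=> /(ramsey_A2b ramseyR)/(_ k)/least_nat[n dn min_n].
by exists n.
Qed.

Lemma depth_unique A a n m : depth_is A a n -> depth_is A a m -> n = m.
Proof.
move=> [an min_n] [am min_m]; apply/eqP.
by rewrite eqn_leq min_n// min_m.
Qed.

Lemma depth_basic_nat A B a n : basic_nat n B A -> depth_is A a n -> depth_is B a n.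
Proof.
move=> /basic_natP[_ eAB] [an min_n]; split=> [|m am]; first by rewrite -eAB.
rewrite leqNgt; apply/negP => ltmn; move: (am).
by rewrite -(r_prefix eAB (ltnW ltmn)) => /min_n; rewrite leqNgt ltmn.
Qed.

Lemma basic_nat_depth A B a n : basic_nat n B A -> depth_is B a n -> depth_is A a n.
Proof.
move=> /basic_natP[_ eAB] [an min_n]; split=> [|m am]; first by rewrite eAB.
rewrite leqNgt; apply/negP => ltmn; move: (am).
by rewrite (r_prefix eAB (ltnW ltmn)) => /min_n; rewrite leqNgt ltmn.
Qed.

(** (A.2)(c) gives an initial segment of [r A n'] above [r X k], and by (A.1)(c) this segment is
    some [r A m] with [m <= n']. *)
Lemma depth_mono A X k k' n n' : k <= k' ->
  depth_is A (r X k) n -> depth_is A (r X k') n' -> n <= n'.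
Proof.
move=> lekk' [_ min_n] [dn' _].
have [|d [C [m [p [lemp -> eAC]]]] dd] := ramsey_A2c ramseyR _ dn' (a := r X k).
  by exists X, k, k'.
have en'p := r_len eAC; subst p.
have := r_prefix eAC lemp => eCA.
apply: leq_trans lemp; apply: min_n; by rewrite eCA.
Qed.

(** The approximations of [X] have different lengths, so there are infinitely many, while (A.2)(a)
    leaves only finitely many of depth below [N]. *)
Lemma depth_unbounded A X N : leR X A ->
  exists k, forall k' n, k <= k' -> depth_is A (r X k') n -> N <= n.
Proof.
move=> leXA; apply: contrapT => /forallNP small.
have fin : finite_set (\bigcup_(n in `I_N) [set a | lefin a (r A n)]).
  apply: bigcup_finite; first exact: finite_II.
  by move=> n _; apply: ramsey_A2a.
apply: infinite_nat; apply: sub_finite_set (finite_image len fin) => k _.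
exists (r X k); last exact: len_r.
have /existsNP[k' /existsNP[n /not_implyP[lekk' /not_implyP[dn]]]] := small k.
move=> /negP; rewrite -ltnNge => ltnN.
have [m dm] := depth_exists k leXA.
have lemn := depth_mono lekk' dm dn.
by exists m => /=; [exact: leq_ltn_trans ltnN | case: dm].
Qed.

Lemma depth_le_finite A n : finite_set [set a | depth_is A a n].
Proof.
by apply: sub_finite_set (ramsey_A2a ramseyR (r A n)) => a [].
Qed.

Hypothesis closedR : closed (range (@approx_seq R)).

Lemma r_limit (x : nat -> AR) :
  (forall n, exists X, forall k, k <= n -> r X k = x k) ->
  exists X, forall k, r X k = x k.
Proof.
move=> approx_x.
pose x' : prod_topology (fun _ : nat => discrete_topology AR) := x.
suff : range (@approx_seq R) x' by case=> X _ eXx; exists X => k; rewrite -[x k]/(x' k) -eXx.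
apply: closedR => U nU.
have [n nU'] := nbhs_prod_nat nU.
have [X eX] := approx_x n; exists (approx_seq X); split; first by exists X.
exact: nU'.
Qed.

(** Stage [n] shrinks inside [[n, A]] and so preserves [r A n]; the diagonal of the resulting
    sequence is an element of [R] because [R] is closed. *)
Lemma fusion (Phi : nat -> R -> Prop) N B :
  (forall n A, N <= n -> basic_nat N B A ->
     exists2 A', basic_nat n A A' & Phi n A') ->
  (forall n A A', Phi n A -> basic_nat n A A' -> Phi n A') ->
  exists2 A, basic_nat N B A & forall n, N <= n -> Phi n A.
Proof.
move=> dense hered.
have [u [u0 _ uS]] : exists u : nat -> R, [/\ u 0 = B, forall n, basic_nat N B (u n) &
    forall i, basic_nat (N + i) (u i) (u i.+1) /\ Phi (N + i) (u i.+1)].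
  apply: (dependent_choice_nat (Q := basic_nat N B)
    (S := fun i A A' => basic_nat (N + i) A A' /\ Phi (N + i) A')) => [|i A BA].
    exact: basic_nat_refl.
  have [A' AA' PA'] := dense (N + i) A (leq_addr _ _) BA.
  exists A' => //; apply: basic_nat_trans BA _.
  exact: basic_nat_le (leq_addr _ _) AA'.
have u_basic i j : i <= j -> basic_nat (N + i) (u i) (u j).
  move=> /subnKC <-; elim: (j - i) => [|d IHd].
    by rewrite addn0; apply: basic_nat_refl.
  apply: basic_nat_trans IHd _; rewrite addnS; apply: basic_nat_le (uS _).1.
  by rewrite addnA leq_addr.
have [A eA] : exists A, forall k, r A k = r (u k) k.
  apply: r_limit => n; exists (u n) => k lekn.
  have /basic_natP[_ eu] := u_basic k n lekn.
  by apply: r_prefix eu _; apply: leq_addl.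
have eAu i : r A (N + i) = r (u i) (N + i).
  rewrite eA; have /basic_natP[_] := u_basic i (N + i) (leq_addl _ _).
  by [].
(* From length [i] on, the limit agrees with later terms, which lie below [u i]; at smaller lengths
   it agrees with [u i] itself. *)
have uA i : basic_nat (N + i) (u i) A.
  apply/basic_natP; split=> //; apply/(ramsey_A2b ramseyR) => n.
  have [lein|/ltnW leni] := leqP i n.
    have /basic_natP[/(ramsey_A2b ramseyR)/(_ n)[m lem] _] := u_basic i n lein.
    by exists m; rewrite eA.
  exists n; rewrite (r_prefix (eAu i)) //; last exact: leq_trans leni (leq_addl _ _).
  by have [refl _] := ramsey_A2 ramseyR; apply: refl.
exists A; first by have := uA 0; rewrite addn0 u0.
move=> n /subnKC <-; apply: hered (uS (n - N)).2 _.
have [leA _] := (basic_natP _ _ _).1 (uA (n - N).+1).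
by apply/basic_natP; split=> //; rewrite eAu; have /basic_natP[_] := (uS (n - N)).1.
Qed.

End Basics.

(** * Deciding sigma-ideals *)

Section Ideals.
Variable R : approxSpace.
Hypothesis ramseyR : topological_ramsey R.
Hypothesis closedR : closed (range (@approx_seq R)).
Local Notation AR := (approx R).
Local Notation len := (len ramseyR).
Implicit Types (A B C X Y : R) (a b c : AR) (n m k : nat).

Lemma finite_shrink (T : choiceType) (S : set T) n A0 (Psi : T -> R -> Prop) :
  finite_set S ->
  (forall t A, S t -> basic_nat n A0 A -> exists2 A', basic_nat n A A' & Psi t A') ->
  (forall t A A', Psi t A -> basic_nat n A A' -> Psi t A') ->
  exists2 A, basic_nat n A0 A & forall t, S t -> Psi t A.
Proof.
move=> /finite_seqP[s ->] dense hered.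
elim: s dense => [|t s IHs] dense; first by exists A0 => //; apply: basic_nat_refl.
have [|A AA0 PA] := IHs.
  by move=> t' A st'; apply: dense; rewrite /= inE st' orbT.
have [|A' A'A Pt] := dense t A _ AA0; first by rewrite /= inE eqxx.
exists A'; first exact: basic_nat_trans AA0 A'A.
move=> t'; rewrite /= inE => /predU1P[->//|st']; apply: hered A'A.
exact: PA.
Qed.

(** Requirement [i] is imposed only at depths at least [i], so each stage of the fusion has finitely
    many pairs of an index and an approximation to treat. *)
Lemma fusion_depth (Psi : nat -> AR -> R -> Prop) N B :
  (forall i a n A, N <= n -> basic_nat N B A -> depth_is A a n ->
     exists2 A', basic_nat n A A' & Psi i a A') ->
  (forall i a A A', leR A' A -> Psi i a A -> Psi i a A') ->
  exists2 A, basic_nat N B A &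
    forall i a n, N <= n -> i <= n -> depth_is A a n -> Psi i a A.
Proof.
move=> dense hered.
have [|n A A' PA AA'|A AB PA] := @fusion R ramseyR closedR
  (fun n A => forall a i, i <= n -> depth_is A a n -> Psi i a A) N B.
- move=> n A leNn BA.
  have [||t A1 A' + A1A'|A' AA' PA'] := @finite_shrink (AR * nat)%type
    ([set a | depth_is A a n] `*` `I_n.+1) n A (fun t => Psi t.2 t.1).
  + by apply: finite_setX; [exact: depth_le_finite | exact: finite_II].
  + move=> [a i] A1 [/= da _] AA1; apply: (dense i a n) => //.
      exact: basic_nat_trans BA (basic_nat_le ramseyR leNn AA1).
    exact: basic_nat_depth da.
  + by apply: hered; case/(basic_natP ramseyR): A1A'.
  exists A' => // a i lein da; apply: (PA' (a, i)); split => //=.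
  exact: depth_basic_nat da.
- move=> a i lein da; apply: (@hered i a A A').
    by case/(basic_natP ramseyR): AA'.
  by apply: PA => //; apply: depth_basic_nat da.
- by exists A => // i a n leNn lein; apply: PA.
Qed.

Definition sigma_ideal (I : set R -> Prop) :=
  [/\ I set0, forall S T, S `<=` T -> I T -> I S &
    forall S : nat -> set R, (forall n, I (S n)) -> I (\bigcup_n S n)].

Lemma sigma_ideal_cover (T : Type) (code : T -> nat) I S (F : T -> set R) :
  injective code -> sigma_ideal I ->
  (forall X, S X -> exists t, I (F t) /\ F t X) -> I S.
Proof.
move=> code_inj [I0 Isub Icup] cover.
pose G n := [set X | exists t, [/\ code t = n, I (F t) & F t X]].
apply: (Isub _ _ _ (Icup G _)) => [X /cover[t [It FX]]|n]; first by exists (code t) => //; exists t.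
have [[t [et It]]|noT] := pselect (exists t, code t = n /\ I (F t)).
  by apply: Isub It => X [t' [et' _]]; rewrite (code_inj t' t) // et et'.
by apply: Isub I0 => X [t [et It _]]; apply: noT; exists t.
Qed.

(** Quantifying over longer approximations and smaller [A'] makes positivity pass to both, which the
    plain condition [~ I (basic a A)] does not. *)
Definition positive (I : set R -> Prop) a A := forall Y m A',
  basic a A Y -> len a <= m -> leR A' A -> basic (r Y m) A' !=set0 ->
  ~ I (basic (r Y m) A').

Definition solved (I : set R -> Prop) a A := I (basic a A) \/ positive I a A.

Lemma basic_ext a A Y m Y' : basic a A Y -> len a <= m -> basic (r Y m) A Y' ->
  basic a A Y'.
Proof.
move=> /(basicP ramseyR)[leYA eYa] lem /(basic_rP ramseyR)[leY'A eY'Y].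
by apply/(basicP ramseyR); split=> //; rewrite (r_prefix ramseyR eY'Y).
Qed.

Lemma basic_self A X m : leR X A -> basic (r X m) A X.
Proof. by move=> leXA; split=> //; exists m. Qed.

Lemma positive_le I a A A' : leR A' A -> positive I a A -> positive I a A'.
Proof.
move=> leA'A pos Y m B /(basic_sub ramseyR leA'A) aY lem leBA'.
by apply: (pos) => //; apply: (leR_trans ramseyR) leA'A.
Qed.

Lemma solved_le I a A A' : sigma_ideal I -> leR A' A -> solved I a A -> solved I a A'.
Proof.
move=> [_ Isub _] leA'A [Ia|pos]; [left|right; exact: positive_le pos].
by apply: Isub Ia; apply: basic_sub.
Qed.

Lemma positive_ext I a A Y m : basic a A Y -> len a <= m ->
  positive I a A -> positive I (r Y m) A.
Proof.
move=> aY lem pos Y' m' A' YY'; rewrite len_r => lem'.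
by apply: pos; [apply: basic_ext YY' | apply: leq_trans lem'].
Qed.

Lemma positive_notI I a A Y m : positive I a A -> basic a A Y -> len a <= m ->
  ~ I (basic (r Y m) A).
Proof.
move=> pos aY lem; apply: (pos Y m A) => //; first exact: leR_refl.
by exists Y; apply: basic_self; case: aY.
Qed.

Lemma positive_self I a A Y : positive I a A -> basic a A Y -> ~ I (basic a A).
Proof.
move=> pos aY; have := positive_notI pos aY (leqnn _).
by case/(basicP ramseyR): aY => _ ->.
Qed.

(** If some smaller nonempty [[a, A1]] is in the ideal, (A.3)(b) replaces [A1] by an element of
    [[n, A]]; otherwise [A] itself works. *)
Lemma decide_ideal I a n A : sigma_ideal I -> depth_is A a n ->
  exists2 A', basic_nat n A A' &
    I (basic a A') \/
    forall A'', leR A'' A' -> basic a A'' !=set0 -> ~ I (basic a A'').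
Proof.
move=> [_ Isub _] da.
have [[A1 [leA1A neA1 IA1]]|none] := pselect (exists A1,
    [/\ leR A1 A, basic a A1 !=set0 & I (basic a A1)]).
  have [n' [dn' [A' A'A [_ subA']]]] := ramsey_A3b ramseyR leA1A neA1.
  rewrite -(depth_unique da dn') in A'A.
  by exists A' => //; left; apply: Isub IA1.
exists A; first exact: basic_nat_refl.
by right=> A'' leA'' neA'' IA''; apply: none; exists A''.
Qed.

Variable code : AR -> nat.
Hypothesis code_inj : injective code.

(** A first fusion decides every extension of [a]; a second one uses (A.4) to make the one-step
    extensions of each of them agree. If [[a, D]] is not in the ideal, non-membership then climbs to
    all extensions of [a] by induction on length. *)
Lemma solve_ideal I a n A : sigma_ideal I -> depth_is A a n ->
  exists2 A', basic_nat n A A' & solved I a A'.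
Proof.
move=> sI da; have [I0 Isub Icup] := sI.
pose decided a A := I (basic a A) \/
  forall A', leR A' A -> basic a A' !=set0 -> ~ I (basic a A').
have decided_le a' A1 A2 : leR A2 A1 -> decided a' A1 -> decided a' A2.
  move=> leA [Ia|dec]; first by left; apply: Isub Ia; apply: basic_sub.
  by right=> A' leA'; apply: dec; apply: (leR_trans ramseyR) leA.
have [||B BA decB] := @fusion_depth (fun _ => decided) n A.
- by move=> _ a' n' A' _ _; apply: decide_ideal.
- by move=> _ a' A1 A2; apply: decided_le.
have leBA : leR B A by case/(basic_natP ramseyR): BA.
have da_B := basic_nat_depth ramseyR BA da.
have depth_ext X m p : basic a B X -> len a <= m -> depth_is B (r X m) p -> n <= p.
  case/(basicP ramseyR) => leXB eXa lem dp.
  by apply: (depth_mono ramseyR lem _ dp); rewrite eXa.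
have decB' X m : basic a B X -> len a <= m -> decided (r X m) B.
  move=> aX lem; have leXB : leR X B by case: aX.
  have [p dp] := depth_exists ramseyR m leXB.
  exact: (decB 0 _ p (depth_ext _ _ _ aX lem dp)).
pose good b A := I (basic b A) \/
  forall X A', basic b A X -> leR A' A -> basic (r X (len b).+1) A' !=set0 ->
    ~ I (basic (r X (len b).+1) A').
pose Psi b A := (exists X m, [/\ basic a B X, len a <= m & b = r X m]) -> good b A.
have [|_ b A1 A2 leA PA1 /PA1[IbA1|gd]|D BD goodD] := @fusion_depth (fun _ => Psi) n B.
- move=> _ b p A1 lenp BA1 db.
  have [|nP] := pselect (exists X m, [/\ basic a B X, len a <= m & b = r X m]);
    last by exists A1 => //; exact: basic_nat_refl.
  case=> X [m [aX lem eb]].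
  have leA1B : leR A1 B by case/(basic_natP ramseyR): BA1.
  have bext Y : basic b A1 Y -> basic a B Y.
    rewrite eb => bY; apply: (basic_ext aX lem); exact: basic_sub bY.
  have leab : len a <= len b by rewrite eb len_r.
  have [IbA1|nIb] : decided b A1.
  + by apply: decided_le leA1B _; rewrite eb; apply: decB'.
  + by exists A1 => [|_]; [exact: basic_nat_refl | left].
  (* Colour a one-step extension of [b] by whether its basic set is in the ideal. If all are,
     countably many of these sets cover [[b, A2]]. *)
  pose O := [set c | AR_ (len b).+1 c /\ I (basic c A1)].
  have [||A2 A1A2 homA2] := ramsey_A4 ramseyR db (k := len b) (O := O).
  + by exists X => //; rewrite eb len_r.
  + by move=> c [].
  have leA2A1 : leR A2 A1 by case/(basic_natP ramseyR): A1A2.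
  exists A2 => // _; case: homA2 => [allO|noO].
  + left; apply: (sigma_ideal_cover (F := fun c => basic c A1) code_inj sI) => Y bY.
    exists (r Y (len b).+1); split; last first.
      by apply/basic_self/(leR_trans ramseyR _ leA2A1); case: bY.
    by have [] := allO (r Y (len b).+1) _; first by exists Y.
  + right=> Y A' bY leA'.
    have bY1 : basic b A1 Y by apply: basic_sub bY.
    have : decided (r Y (len b).+1) A1.
      by apply: decided_le leA1B _; apply: decB' (bext _ bY1) _; apply: leqW.
    case=> [IY|]; last by apply; apply: (leR_trans ramseyR) leA2A1.
    have : ([set r C (len b).+1 | C in basic b A2] `&` O) (r Y (len b).+1).
      split; first by exists Y.
      by split=> //; exists Y.
    by rewrite noO.
- by left; apply: Isub IbA1; apply: basic_sub.
- right=> X A' bX leA'; apply: gd; first exact: basic_sub leA _ bX.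
  exact: (leR_trans ramseyR) leA' leA.
have leDB : leR D B by case/(basic_natP ramseyR): BD.
have AD : basic_nat n A D by apply: (basic_nat_trans ramseyR) BA BD.
exists D => //.
have [IaD|nIaD] := pselect (I (basic a D)); [by left | right].
have goodD' X m : basic a D X -> len a <= m -> good (r X m) D.
  move=> aX lem; have aXB : basic a B X by apply: basic_sub aX.
  have leXD : leR X D by case: aX.
  have [p dp] := depth_exists ramseyR m leXD.
  apply: (goodD 0 _ p) => //; last by exists X, m.
  have da_D := basic_nat_depth ramseyR AD da.
  case/(basicP ramseyR): aX => _ eXa.
  by apply: (depth_mono ramseyR lem _ dp); rewrite eXa.
have dec_a : decided a D.
  have [[X aX]|naD] := pselect (basic a D !=set0).
    have [_ eX] := (basicP ramseyR _ _ _).1 aX.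
    apply: decided_le (leDB) _; rewrite -[X in decided X _]eX.
    by apply: decB' => //; apply: basic_sub aX.
  by right=> A' leA' [X aX]; case: naD; exists X; apply: basic_sub aX.
move=> X m A' aX lem; rewrite -(subnKC lem).
(* [A'] is generalized because the induction hypothesis is used at [D], to exclude the first
   alternative of [good]. *)
elim: (m - len a) A' => [|d IHd] A' leA' neA'.
  case: dec_a => // dec; have eX : r X (len a) = a by case/(basicP ramseyR): aX.
  by rewrite addn0 eX in neA' *; apply: dec.
rewrite addnS in neA' *.
have leXD : leR X D by case: aX.
have [IX|] := goodD' X (len a + d) aX (leq_addr _ _).
  case: (IHd D (leR_refl ramseyR D)) => //.
  by exists X; apply: basic_self.
rewrite len_r => /(_ X A'); apply=> //; exact: basic_self.
Qed.

End Ideals.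

(** * Continuous partial functions with closed domain *)

Section PartialContinuous.
Variable R : approxSpace.
Hypothesis ramseyR : topological_ramsey R.
Implicit Types (A X Y Z : R) (n m k j : nat) (h : R -> R -> Prop).

Definition cyl_open (V : set R) :=
  forall X, V X -> exists k, forall X', r X' k = r X k -> V X'.

Definition cyl_closed (V : set R) := cyl_open (~` V).

(* Graphs of continuous partial functions with closed domain. *)
Definition pcont h :=
  [/\ forall X Y Y', h X Y -> h X Y' -> Y = Y',
      forall X j, exists k c, forall X' Y', r X' k = r X k -> h X' Y' -> r Y' j = c &
      forall X, (forall Y, ~ h X Y) ->
        exists k, forall X' Y', r X' k = r X k -> ~ h X' Y'].

Lemma cyl_closed_below A : cyl_closed (below A).
Proof.
move=> X /=; rewrite /below /= (ramsey_A2b ramseyR) => /existsNP[n nXn].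
by exists n => X' eX' /= /(ramsey_A2b ramseyR)/(_ n); rewrite eX'.
Qed.

Lemma cyl_closed_r k c : cyl_closed [set X | r X k = c].
Proof. by move=> X /= neq; exists k => X' /= ->. Qed.

Lemma cyl_closed_basic a A : cyl_closed (basic a A).
Proof.
move=> X /=; rewrite (basicP ramseyR) => /not_andP[].
  by move=> /(@cyl_closed_below A)[k kP]; exists k => X' /kP nX' [].
by move=> neX; exists (len ramseyR a) => X' eX' /(basicP ramseyR)[_]; rewrite eX'.
Qed.

Lemma pcont_id : pcont eq.
Proof.
split=> [X Y Y' -> //|X j|X /(_ X)[]//].
by exists j, (r X j) => X' Y' <- ->.
Qed.

Lemma pcont_empty : pcont (fun _ _ => False).
Proof.
split=> // [X j|X _]; last by exists 0 => ? ? _ [].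
by exists j, (r X j) => ? ? _ [].
Qed.

Lemma pcont_near h X Y j : pcont h -> h X Y ->
  exists k, forall X' Y', r X' k = r X k -> h X' Y' -> r Y' j = r Y j.
Proof.
move=> [_ cont _] hXY; have [k [c kP]] := cont X j.
by exists k => X' Y' eX' /(kP _ _ eX') ->; rewrite (kP X Y).
Qed.

Lemma pcont_comp h1 h2 : pcont h1 -> pcont h2 ->
  pcont (fun X Z => exists2 Y, h1 X Y & h2 Y Z).
Proof.
move=> p1 p2; have [fun1 cont1 dom1] := p1; have [fun2 cont2 dom2] := p2; split.
- by move=> X Z Z' [Y h1Y h2Y] [Y' /(fun1 _ _ _ h1Y) <-]; apply: fun2.
- move=> X j; have [[Y hXY]|/forallNP/dom1[k kP]] := pselect (exists Y, h1 X Y); last first.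
    by exists k, (r X j) => X' Z' eX' [Y' /(kP _ _ eX')].
  have [l [c lP]] := cont2 Y j; have [k kP] := pcont_near l p1 hXY.
  exists k, c => X' Z' eX' [Y' h1Y' h2Z']; apply: lP h2Z'; exact: kP h1Y'.
- move=> X noZ; have [[Y hXY]|/forallNP/dom1[k kP]] := pselect (exists Y, h1 X Y); last first.
    by exists k => X' Z' eX' [Y' /(kP _ _ eX')].
  have [Z hYZ|l lP] := dom2 Y; first by apply: (noZ Z); exists Y.
  have [k kP] := pcont_near l p1 hXY.
  by exists k => X' Z' eX' [Y' h1Y' h2Z']; apply: lP h2Z'; exact: kP h1Y'.
Qed.

(** The domain is the set where [h2] inverts [h1]. It is closed because, by continuity, finite
    approximations detect that [h2] sends [h1 X] to a point other than [X]. *)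
Lemma pcont_inv h1 h2 : pcont h1 -> pcont h2 ->
  pcont (fun X Y => h1 X Y /\ h2 Y X).
Proof.
move=> p1 p2; have [fun1 cont1 dom1] := p1; have [fun2 cont2 dom2] := p2; split.
- by move=> X Y Y' [hY _] [hY' _]; apply: fun1 hY hY'.
- move=> X j; have [k [c kP]] := cont1 X j; exists k, c => X' Y' eX' [hX' _].
  exact: kP hX'.
- move=> X noY; have [[Y hXY]|/forallNP/dom1[k kP]] := pselect (exists Y, h1 X Y); last first.
    by exists k => X' Z' eX' [/(kP _ _ eX')].
  have [[W hYW]|/forallNP/dom2[l lP]] := pselect (exists W, h2 Y W); last first.
    have [k kP] := pcont_near l p1 hXY.
    by exists k => X' Y' eX' [/(kP _ _ eX')/lP nY' /nY'].
  have /(r_sep ramseyR)[j jP] : W <> X by move=> eWX; case: (noY Y); rewrite -{2}eWX.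
  have [l lP] := pcont_near j p2 hYW.
  have [k kP] := pcont_near l p1 hXY.
  exists (maxn k j) => X' Y' eX' [hX'Y' hY'X']; apply: (jP j (leqnn _)).
  rewrite -(lP Y' X') //; first by apply: (r_prefix ramseyR eX'); apply: leq_maxr.
  by apply: kP hX'Y'; apply: (r_prefix ramseyR eX'); apply: leq_maxl.
Qed.

Lemma pcont_dom h V : pcont h -> cyl_closed V -> pcont (fun X Y => V X /\ h X Y).
Proof.
move=> [func cont dom] cV; split.
- by move=> X Y Y' [_ hY] [_ hY']; apply: func hY hY'.
- move=> X j; have [k [c kP]] := cont X j; exists k, c => X' Y' eX' [_ hX'].
  exact: kP hX'.
- move=> X noY; have [VX|/cV[k kP]] := pselect (V X).
    have [Y hY|k kP] := dom X; first by apply: (noY Y).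
    by exists k => X' Y' /kP nX' [_ /nX'].
  by exists k => X' Y' /kP nX' [/nX'].
Qed.

Lemma pcont_closed_dom h : pcont h -> cyl_closed [set X | exists Y, h X Y].
Proof.
move=> [_ _ dom] X /= /forallNP/dom[k kP]; exists k => X' /kP nX' [Y].
exact: nX'.
Qed.

Lemma pcont_cod h V : pcont h -> cyl_closed V -> pcont (fun X Y => h X Y /\ V Y).
Proof.
move=> ph cV.
have -> : (fun X Y => h X Y /\ V Y) = (fun X Z => exists2 Y, h X Y & V Y /\ Y = Z).
  apply/funext => X; apply/funext => Y; apply/propext; split=> [[hXY VY]|[Z hXZ [VZ <-]]//].
  by exists Y.
by apply: pcont_comp => //; apply: pcont_dom => //; apply: pcont_id.
Qed.

Lemma pcont_preimage h V : pcont h -> cyl_closed V ->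
  cyl_closed [set X | exists2 Y, h X Y & V Y].
Proof.
move=> ph /(pcont_cod ph)/pcont_closed_dom cV X nX.
have [[Y [hXY VY]]|k kP] := cV X; first by apply: nX; exists Y.
by exists k => X' /kP nX' [Y hY VY]; apply: nX'; exists Y.
Qed.

Hypothesis closedR : closed (range (@approx_seq R)).
Variable code : approx R -> nat.
Hypothesis code_inj : injective code.

(** The subsets of [V] form a sigma-ideal. In the positive case no [X] in [[a, A']] lies in [V], as
    a basic set around [X] would be contained in [V]. *)
Lemma open_ramsey V a n A : cyl_open V -> depth_is A a n ->
  exists2 A', basic_nat n A A' &
    basic a A' `<=` V \/ forall X, basic a A' X -> ~ V X.
Proof.
move=> oV da; have sI : sigma_ideal (fun S : set R => S `<=` V).
  split=> [X []|S T ST TV X /ST/TV//|S SV X [i _]]; exact: SV.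
have [A' AA' [IaA'|pos]] := solve_ideal ramseyR closedR code_inj sI da.
  by exists A' => //; left.
exists A' => //; right=> X aX VX; have [k kP] := oV X VX.
apply: (positive_notI pos aX (leq_maxl _ k)) => Y /(basic_rP ramseyR)[_ eY].
by apply: kP; apply: (r_prefix ramseyR eY); apply: leq_maxr.
Qed.

End PartialContinuous.

(** * Uniformization of E by continuous partial functions *)

Section Uniformization.
Variable R : approxSpace.
Hypothesis ramseyR : topological_ramsey R.
Hypothesis closedR : closed (range (@approx_seq R)).
Local Notation AR := (approx R).
Local Notation len := (len ramseyR).
Local Notation positive := (positive ramseyR).
Local Notation solved := (solved ramseyR).
Variable code : AR -> nat.
Hypothesis code_inj : injective code.
Implicit Types (A B X Y : R) (a b c : AR) (n m k i : nat) (w : nat -> nat).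

Variable E : R -> R -> Prop.
(** A Suslin presentation of [E]: a closed set of triples, with third coordinate in Baire space,
    that projects onto [E]. *)
Variable C : R -> R -> (nat -> nat) -> Prop.
Hypothesis EC : forall X Y, E X Y <-> exists w, C X Y w.
Hypothesis closedC : forall X Y w, ~ C X Y w -> exists k, forall X' Y' w',
  r X' k = r X k -> r Y' k = r Y k -> (forall i, i < k -> w' i = w i) -> ~ C X' Y' w'.
Hypothesis countableE : forall X, countable [set Y | E X Y].

Definition covered (Q : R -> R -> Prop) (S : set R) :=
  exists H : nat -> R -> R -> Prop,
    [/\ forall i, pcont (H i), forall i X Y, H i X Y -> E X Y &
      forall X Y, S X -> Q X Y -> exists i, H i X Y].

Lemma covered_sub (Q Q' : R -> R -> Prop) (S S' : set R) :
  (forall X Y, Q X Y -> Q' X Y) -> S `<=` S' -> covered Q' S' -> covered Q S.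
Proof.
move=> QQ' SS' [H [pH HE cover]]; exists H; split=> // X Y /SS' SX /QQ'.
exact: cover.
Qed.

Lemma covered_bigcup (T : Type) (codeT : T -> nat) (Q : R -> R -> Prop) (S : set R)
    (Q' : T -> R -> R -> Prop) (S' : T -> set R) :
  injective codeT ->
  (forall X Y, S X -> Q X Y -> exists t, [/\ covered (Q' t) (S' t), S' t X & Q' t X Y]) ->
  covered Q S.
Proof.
move=> codeT_inj cover.
have /choice[H HP] n : exists Hn : nat -> R -> R -> Prop,
    [/\ forall i, pcont (Hn i), forall i X Y, Hn i X Y -> E X Y &
     forall t, codeT t = n -> covered (Q' t) (S' t) ->
       forall X Y, S' t X -> Q' t X Y -> exists i, Hn i X Y].
  have [[t [et [Hn [pH HE covn]]]]|noT] :=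
      pselect (exists t, codeT t = n /\ covered (Q' t) (S' t)).
    by exists Hn; split=> // t'; rewrite -et => /codeT_inj ->.
  exists (fun _ _ _ => False); split=> // [i|t et ct]; first exact: pcont_empty.
  by case: noT; exists t.
exists (fun i X Y => if @unpickle (nat * nat)%type i is Some p then H p.1 p.2 X Y else False).
split=> [i|i X Y|X Y SX QXY].
- case: unpickle => [[n j]|]; last exact: pcont_empty.
  by have [pH _ _] := HP n; apply: pH.
- by case: unpickle => [[n j] /=|//]; have [_ HE _] := HP n; apply: HE.
- have [t [ct S'X Q'X]] := cover X Y SX QXY.
  have [_ _ cov] := HP (codeT t); have [j Hj] := cov t erefl ct X Y S'X Q'X.
  by exists (pickle (codeT t, j)); rewrite pickleK.
Qed.

(** * The tree of approximations to related points and their witnesses *)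

Definition node := (AR * seq nat)%type.

Definition node_code (t : node) : nat := pickle (code t.1, t.2).

Lemma node_code_inj : injective node_code.
Proof.
by move=> [b u] [b' u'] /(pcan_inj pickleK)[/code_inj -> ->].
Qed.

Definition node_of Y w k : node := (r Y k, mkseq w k).

Definition lvl (t : node) := size t.2.

Lemma lvl_node Y w k : lvl (node_of Y w k) = k.
Proof. by rewrite /lvl size_mkseq. Qed.

Lemma node_ofP Y w Y' w' k : node_of Y w k = node_of Y' w' k <->
  r Y k = r Y' k /\ forall i, i < k -> w i = w' i.
Proof.
split=> [e|[eY ew]].
  split=> [|i ltik]; first exact: (congr1 fst e).
  by have := congr1 (fun t : node => nth 0 t.2 i) e; rewrite /= !nth_mkseq.
congr pair => //; apply: (@eq_from_nth _ 0) => [|i]; rewrite !size_mkseq // => ltik.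
by rewrite !nth_mkseq // ew.
Qed.

Lemma node_prefix Y w Y' w' k k' : node_of Y w k' = node_of Y' w' k' -> k <= k' ->
  node_of Y w k = node_of Y' w' k.
Proof.
move=> /node_ofP[eY ew] lekk'; apply/node_ofP; split=> [|i ltik].
  exact: (r_prefix ramseyR eY).
by apply: ew; apply: leq_trans ltik lekk'.
Qed.

Definition part (t : node) X Y := exists2 w, C X Y w & t = node_of Y w (lvl t).

Definition ext (t t' : node) := lvl t <= lvl t' /\
  exists Y w, t = node_of Y w (lvl t) /\ t' = node_of Y w (lvl t').

Lemma ext_trans t t' t'' : ext t t' -> ext t' t'' -> ext t t''.
Proof.
move=> [le1 [Y [w [et et']]]] [le2 [Y' [w' [et1' et'']]]]; split.
  exact: leq_trans le1 le2.
exists Y', w'; split=> //; rewrite et lvl_node; apply: node_prefix le1.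
by rewrite -et' -et1'.
Qed.

Lemma ext_node Y w k k' : k <= k' -> ext (node_of Y w k) (node_of Y w k').
Proof. by move=> lekk'; split; rewrite ?lvl_node //; exists Y, w; rewrite ?lvl_node. Qed.

(** Nodes that differ only in the witness part may admit a common [Y]. To obtain distinct elements
    of a class, the [Y] parts themselves must be separated. *)
Definition incompat (t t' : node) := forall Y Y' w w',
  t = node_of Y w (lvl t) -> t' = node_of Y' w' (lvl t') -> Y <> Y'.

Definition thin t S := covered (part t) S.

Lemma thin_sigma t : sigma_ideal (thin t).
Proof.
split=> [|S T ST|S thinS].
- by exists (fun _ _ _ => False); split=> // i; apply: pcont_empty.
- exact: covered_sub.
- apply: (covered_bigcup (codeT := id) (Q' := fun _ => part t) (S' := S)) => //.
  move=> X Y [i _ SX] tXY; exists i; split=> //; exact: thinS.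
Qed.

Definition child t t' := ext t t' /\ lvl t' = (lvl t).+1.

Definition branching t a A := thin t (basic a A) \/ forall X, basic a A X ->
  exists m t', [/\ len a <= m, child t t' & positive (thin t') (r X m) A].

Lemma branching_le t a A A' : leR A' A -> branching t a A -> branching t a A'.
Proof.
move=> leA [thin_t|br]; [left|right].
  by have [_ sub _] := thin_sigma t; apply: sub thin_t; apply: basic_sub.
move=> X aX; have [|m [t' [lem ct' pos]]] := br X; first exact: basic_sub leA _ aX.
by exists m, t'; split=> //; apply: positive_le pos.
Qed.

Lemma eventually_deep A X m0 N : leR X A ->
  exists m n, [/\ m0 <= m, N <= n & depth_is A (r X m) n].
Proof.
move=> leXA; have [k kP] := depth_unbounded ramseyR N leXA.
have [n dn] := depth_exists ramseyR (maxn m0 k) leXA.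
by exists (maxn m0 k), n; split; rewrite ?leq_maxl //; apply: kP dn; apply: leq_maxr.
Qed.

(** Once all [thin t'] are solved, the set [V] of points with a positive child of [t] is open, hence
    Ramsey. If [[a, A']] misses [V], countably many thin parts of children cover the part of [t]. *)
Lemma branching_dense t a n A : depth_is A a n ->
  exists2 A', basic_nat n A A' & branching t a A'.
Proof.
move=> da.
have [||B AB solB] := @fusion_depth R ramseyR closedR
  (fun i b A' => forall t', node_code t' = i -> solved (thin t') b A') n A.
- move=> i b p A1 _ _ db; have [[t' et']|noT] := pselect (exists t', node_code t' = i).
    have [A2 A12 sol] := solve_ideal ramseyR closedR code_inj (thin_sigma t') db.
    by exists A2 => // t''; rewrite -et' => /node_code_inj ->.
  exists A1; first exact: basic_nat_refl.
  by move=> t' et'; case: noT; exists t'.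
- move=> i b A1 A2 leA sol t' et'; apply: solved_le (thin_sigma t') leA _.
  exact: sol.
pose V := [set X | exists m t', [/\ len a <= m, child t t' & positive (thin t') (r X m) B]].
have oV : cyl_open V.
  by move=> X [m [t' [lem ct' pos]]]; exists m => X' eX'; exists m, t'; rewrite eX'.
have da_B := basic_nat_depth ramseyR AB da.
have [A' BA' [inV|notV]] := open_ramsey ramseyR closedR code_inj oV da_B.
  exists A'; first exact: basic_nat_trans AB BA'.
  have leA'B : leR A' B by case/(basic_natP ramseyR): BA'.
  right=> X /inV[m [t' [lem ct' pos]]]; exists m, t'; split=> //.
  exact: positive_le pos.
exists A'; first exact: basic_nat_trans AB BA'.
have leA'B : leR A' B by case/(basic_natP ramseyR): BA'.
left; pose codeT (p : AR * node) := pickle (code p.1, node_code p.2).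
apply: (covered_bigcup (codeT := codeT) (Q' := fun p => part p.2) (S' := fun p => basic p.1 B)).
  by move=> [b t1] [b' t2] /(pcan_inj pickleK)[/code_inj -> /node_code_inj ->].
move=> X Y aX [w CXY et].
pose t' := node_of Y w (lvl t).+1.
have ct' : child t t' by split; rewrite ?lvl_node // et; exact: ext_node (leqnSn _).
have aXB : basic a B X by apply: basic_sub aX.
have leXB : leR X B by case: aXB.
(* The fusion has treated [t'] only at depths at least its code, so a sufficiently deep
   approximation of [X] is taken. *)
have [m [p [lem ledp dp]]] := eventually_deep (len a) (maxn n (node_code t')) leXB.
move: ledp; rewrite geq_max => /andP[lenp letp].
exists (r X m, t'); split=> /=; last by exists w => //; rewrite lvl_node.
  have [//|pos] := solB _ _ _ lenp letp dp t' erefl.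
  by case: (notV X aX); exists m, t'.
exact: basic_self.
Qed.

(** * Splitting positive nodes into a perfect set *)

Section Split.
Variable A : R.
Hypothesis solvedA : forall t a n, node_code t <= n -> depth_is A a n -> solved (thin t) a A.
Hypothesis branchingA : forall t a n, node_code t <= n -> depth_is A a n -> branching t a A.

Lemma positive_node t a X : basic a A X -> positive (thin t) a A ->
  exists X' Y w, [/\ basic a A X', C X' Y w & t = node_of Y w (lvl t)].
Proof.
move=> aX pos; apply: contrapT => noC; apply: (positive_self pos aX).
exists (fun _ _ _ => False); split=> // [i|X' Y aX' [w CX'Y et]]; first exact: pcont_empty.
by case: noC; exists X', Y, w.
Qed.

Lemma positive_child t a X : basic a A X -> positive (thin t) a A ->
  exists m t', [/\ len a <= m, child t t' & positive (thin t') (r X m) A].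
Proof.
move=> aX pos; have leXA : leR X A by case: aX.
have [m [p [lem ledp dp]]] := eventually_deep (len a) (node_code t) leXA.
have [thin_t|] := branchingA ledp dp.
  by case: (positive_notI pos aX lem).
move=> /(_ X (basic_self m leXA))[m' [t' [lem' ct' pos']]]; exists m', t'; split=> //.
by apply: leq_trans lem'; rewrite len_r.
Qed.

(** Positivity supplies triples of [C] through each [t i] over [[r X (m i), A]]; they converge to a
    triple with first coordinate [X], and [C] is closed. *)
Lemma positive_branch X (t : nat -> node) (m : nat -> nat) : leR X A ->
  (forall i, ext (t i) (t i.+1)) -> (forall i, i <= lvl (t i)) -> (forall i, i <= m i) ->
  (forall i, positive (thin (t i)) (r X (m i)) A) ->
  exists Y w, (forall i, t i = node_of Y w (lvl (t i))) /\ C X Y w.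
Proof.
move=> leXA ext_t lvl_t le_m pos.
have extP i j : i <= j -> ext (t i) (t j).
  move=> /subnKC <-; elim: (j - i) => [|d IHd]; last first.
    by rewrite addnS; apply: ext_trans (ext_t _).
  rewrite addn0; have [X' [Y [w [_ _ et]]]] := positive_node (basic_self (m i) leXA) (pos i).
  by split=> //; exists Y, w.
have /choice[Z ZP] i : exists Z : R * R * (nat -> nat),
    [/\ r Z.1.1 (m i) = r X (m i), C Z.1.1 Z.1.2 Z.2 & t i = node_of Z.1.2 Z.2 (lvl (t i))].
  have [X' [Y [w [aX' CX'Y et]]]] := positive_node (basic_self (m i) leXA) (pos i).
  by exists (X', Y, w); split=> //=; case/(basic_rP ramseyR): aX'.
have coh i j k : k <= i -> i <= j ->
    node_of (Z i).1.2 (Z i).2 k = node_of (Z j).1.2 (Z j).2 k.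
  move=> leki leij; have [_ _ ei] := ZP i; have [_ _ ej] := ZP j.
  have [leij' [Y [w [eti etj]]]] := extP i j leij.
  apply: (node_prefix (k' := lvl (t i))); last exact: leq_trans leki (lvl_t i).
  rewrite -ei eti lvl_node; apply: node_prefix leij'; by rewrite -etj -ej.
have [Y YP] : exists Y, forall k, r Y k = r (Z k).1.2 k.
  apply: (r_limit closedR (x := fun k => r (Z k).1.2 k)) => n; exists (Z n).1.2 => k lekn.
  by case: (coh k n k (leqnn k) lekn).
pose w k := (Z k.+1).2 k.
have wP k : node_of Y w k = node_of (Z k).1.2 (Z k).2 k.
  apply/node_ofP; split=> [|i ltik]; first exact: YP.
  by have /node_ofP[_ /(_ i (ltnSn i))] := coh i.+1 k i.+1 (leqnn _) ltik.
exists Y, w; split=> [i|].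
  have [_ _ ei] := ZP i; have [leil|ltli] := leqP i (lvl (t i)); last first.
    by rewrite ltnNge lvl_t in ltli.
  have := extP i (lvl (t i)) leil => -[le' [Y' [w' [e1 e2]]]].
  rewrite wP e1 lvl_node; have [_ _ el] := ZP (lvl (t i)).
  by apply: node_prefix le'; rewrite -e2 -el.
apply: contrapT => /closedC[k kP].
have [eX CZ _] := ZP k; have /node_ofP[eY ew] := wP k.
apply: (kP _ _ _ _ _ _ CZ); first exact: (r_prefix ramseyR eX).
  by rewrite eY.
by move=> i ltik; rewrite ew.
Qed.

(** Without a splitting, the positive extensions of [t0] over each [X] in [[a, A]] describe a single
    [Y]. This defines a continuous function inside [E], which together with countably many thin
    parts covers the part of [t0], contrary to positivity. *)
Lemma split_exists t0 a X0 : basic a A X0 -> positive (thin t0) a A ->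
  exists X m t' t'', [/\ basic a A X, len a <= m, ext t0 t' & ext t0 t''] /\
    [/\ incompat t' t'', positive (thin t') (r X m) A & positive (thin t'') (r X m) A].
Proof.
move=> aX0 pos; apply: contrapT => nosplit.
have agree X m t' t'' Y w Y' w' k : basic a A X -> len a <= m ->
    ext t0 t' -> ext t0 t'' -> positive (thin t') (r X m) A ->
    positive (thin t'') (r X m) A -> t' = node_of Y w (lvl t') ->
    t'' = node_of Y' w' (lvl t'') -> k <= lvl t' -> k <= lvl t'' -> r Y k = r Y' k.
  move=> aX lem ext' ext'' pos' pos'' et' et'' lek' lek''.
  have : ~ incompat t' t'' by move=> inc; apply: nosplit; exists X, m, t', t''.
  move=> /existsNP[Y1 /existsNP[Y1' /existsNP[w1 /existsNP[w1'
    /not_implyP[e1 /not_implyP[e1' /contrapT eY]]]]]]; subst Y1'.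
  have /node_ofP[-> _] := node_prefix (etrans (esym et') e1) lek'.
  by have /node_ofP[-> _] := node_prefix (etrans (esym et'') e1') lek''.
(* [Y] is described by arbitrarily long positive extensions of [t0] over [X]; different [k] may use
   different witnesses. *)
pose H X Y := basic a A X /\ forall k, exists m t' w, [/\ len a <= m, k <= lvl t',
  ext t0 t', t' = node_of Y w (lvl t') & positive (thin t') (r X m) A].
have Hnear X Y k : H X Y -> exists m, forall X' Y', r X' m = r X m -> H X' Y' ->
    r Y' k = r Y k.
  move=> [aX /(_ k)[m [t' [w [lem lek ext' et' pos']]]]]; exists m => X' Y' eX'.
  move=> [aX' /(_ k)[m' [t'' [w' [lem' lek' ext'' et'' pos'']]]]].
  have leM : len a <= maxn m m' by apply: leq_trans lem (leq_maxl _ _).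
  have leX'A : leR X' A by case: aX'.
  apply: (@agree X' (maxn m m') t'' t' Y' w' Y w k) => //.
    apply: (positive_ext (basic_self m' leX'A)) pos''.
    by rewrite len_r leq_maxr.
  rewrite -eX' in pos'; apply: (positive_ext (basic_self m leX'A)) pos'.
  by rewrite len_r leq_maxl.
have Htotal X : basic a A X -> exists2 Y, H X Y & E X Y.
  move=> aX; have leXA : leR X A by case: aX.
  (* Descend through positive children; levels and lengths have to tend to infinity for
     [positive_branch]. *)
  have [u [u0 uQ uS]] : exists u : nat -> nat * node, [/\ u 0 = (len a, t0),
      forall n, [/\ ext t0 (u n).2, len a <= (u n).1 & positive (thin (u n).2) (r X (u n).1) A] &
      forall n, [/\ ext (u n).2 (u n.+1).2, lvl (u n.+1).2 = (lvl (u n).2).+1 &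
        (u n).1 < (u n.+1).1]].
    apply: (dependent_choice_nat
      (Q := fun x => [/\ ext t0 x.2, len a <= x.1 & positive (thin x.2) (r X x.1) A])
      (S := fun n x y => [/\ ext x.2 y.2, lvl y.2 = (lvl x.2).+1 & x.1 < y.1])).
      split=> //=; last by case/(basicP ramseyR): (aX) => _ ->.
      by have [X' [Y [w [_ _ ->]]]] := positive_node aX pos; apply: ext_node.
    move=> _ [m t] /= [ext_t lem post].
    have [m' [t' [lem' [ext' lvl'] pos']]] := positive_child (basic_self m leXA) post.
    rewrite len_r in lem'; exists (m'.+1, t'); split=> //=.
    + exact: ext_trans ext'.
    + by apply: leq_trans lem _; apply: leqW.
    + by apply: positive_ext pos'; [exact: basic_self | rewrite len_r].
  have le_lvl n : n <= lvl (u n).2.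
    by elim: n => // n IHn; have [_ -> _] := uS n.
  have le_fst n : n <= (u n).1.
    by elim: n => // n IHn; have [_ _] := uS n; apply: leq_ltn_trans.
  have [Y [w [eu CXY]]] := @positive_branch X (fun n => (u n).2) (fun n => (u n).1) leXA
    (fun n => let: And3 e _ _ := uS n in e) le_lvl le_fst
    (fun n => let: And3 _ _ p := uQ n in p).
  exists Y; last by apply/EC; exists w.
  split=> // k; exists (u k).1, (u k).2, w.
  by have [ext_u lem posu] := uQ k; split.
have pH : pcont H; first split.
- move=> X Y Y' HY HY'; apply: (r_inj ramseyR) => k.
  by have [m mP] := Hnear X Y k HY; rewrite (mP X Y').
- move=> X j; have [aX|/(cyl_closed_basic ramseyR)[k kP]] := pselect (basic a A X); last first.
    by exists k, (r X j) => X' Y' /kP naX' [].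
  have [Y HY _] := Htotal X aX; have [m mP] := Hnear X Y j HY.
  by exists m, (r Y j).
- move=> X noY; have [/Htotal[Y HY _]|/(cyl_closed_basic ramseyR)[k kP]] :=
    pselect (basic a A X); first by case: (noY Y).
  by exists k => X' Y' /kP naX' [].
apply: (positive_self pos aX0).
pose codeT (o : option (AR * node)) : nat :=
  pickle (omap (fun p => (code p.1, node_code p.2)) o).
apply: (covered_bigcup (codeT := codeT)
  (Q' := fun o => if o is Some p then part p.2 else H)
  (S' := fun o => if o is Some p then basic p.1 A else basic a A)).
  move=> [[b t1]|] [[b' t2]|] /(pcan_inj pickleK) //=.
  by move=> [/code_inj -> /node_code_inj ->].
move=> X Y aX [w CXY et0]; have leXA : leR X A by case: aX.
(* Either some node along [(Y, w)] is thin near [X], or, all being solved, nodes of arbitrarily high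
   level are positive and [H X Y] holds. The index [None] stands for [H]. *)
have [[k [m th]]|nothin] := pselect (exists k m, thin (node_of Y w k) (basic (r X m) A)).
  exists (Some (r X m, node_of Y w k)); split=> //=; first exact: basic_self.
  by exists w => //; rewrite lvl_node.
exists None; split=> //.
  exists (fun _ => H); split=> // [i X' Y' HX'Y'|]; last by exists 0.
  have [aX' _] := HX'Y'; have [Y1 HY1 EY1] := Htotal X' aX'.
  by have [func _ _] := pH; rewrite (func _ _ _ HX'Y' HY1).
split=> // k; pose K := maxn k (lvl t0).
have [m [p [lem ledp dp]]] := eventually_deep (len a) (node_code (node_of Y w K)) leXA.
exists m, (node_of Y w K), w; rewrite lvl_node leq_maxl; split=> //.
  by rewrite et0; apply: ext_node; apply: leq_maxr.
have [th|//] := solvedA ledp dp.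
by case: nothin; exists K, m.
Qed.

Lemma incompat_sym t t' : incompat t t' -> incompat t' t.
Proof. by move=> inc Y Y' w w' e e' eY; apply: (inc Y' Y w' w). Qed.

(** At equal levels [t'] would be [t], and any pair through [t''] would pass through both. *)
Lemma incompat_lvl t t' t'' : ext t t' -> ext t t'' -> incompat t' t'' -> lvl t < lvl t'.
Proof.
move=> [le' [Y [w [e1 e1']]]] [_ [Y' [w' [e2 e2']]]] inc.
rewrite ltn_neqAle le' andbT; apply/eqP => elvl.
by apply: (inc Y' Y' w' w') => //; rewrite -elvl -e2 e1 elvl.
Qed.

(** The nodes are split one after the other, moving [X] beyond the current approximation; splits
    already found stay positive by [positive_ext]. *)
Lemma split_list (ts : seq node) X m : leR X A ->
  (forall t, t \in ts -> positive (thin t) (r X m) A) ->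
  exists X' m' (s : node -> node * node), [/\ basic (r X m) A X', m <= m' &
    forall t, t \in ts -> [/\ ext t (s t).1, ext t (s t).2, incompat (s t).1 (s t).2,
      positive (thin (s t).1) (r X' m') A & positive (thin (s t).2) (r X' m') A]].
Proof.
move=> leXA; elim: ts => [|t ts IHts] pos.
  by exists X, m, (fun t => (t, t)); split=> //; apply: basic_self.
have [|X1 [m1 [s [XX1 lem1 sP]]]] := IHts.
  by move=> t' tst'; apply: pos; rewrite inE tst' orbT.
have leX1A : leR X1 A by case: XX1.
have post : positive (thin t) (r X1 m1) A.
  apply: positive_ext (basic_self m leX1A) _ _; first by rewrite len_r.
  by case/(basic_rP ramseyR): XX1 => _ ->; apply: pos; rewrite inE eqxx.
have [X2 [m2 [t' [t'' [[X12 lem2 ext' ext''] [inc pos' pos'']]]]]] :=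
  split_exists (basic_self m1 leX1A) post.
rewrite len_r in lem2.
exists X2, m2, (fun x => if x \in ts then s x else (t', t'')); split.
- by apply: basic_ext XX1 _ X12; rewrite len_r.
- exact: leq_trans lem1 lem2.
move=> x; rewrite inE; case: ifP => [tsx _|_ /predU1P[->|//]] //.
have [e1 e2 i12 p1 p2] := sP x tsx.
have leX2A : leR X2 A by case: X12.
have eX2 : r X2 m1 = r X1 m1 by case/(basic_rP ramseyR): X12.
by split=> //; apply: positive_ext (basic_self m1 leX2A) _ _; rewrite ?len_r ?eX2.
Qed.

(** A Cantor scheme: all nodes on the current list are split while [X] is refined. In the limit each
    [f : nat -> bool] yields a point related to the same [Xl], and different [f] yield different
    points, so the class of [Xl] is uncountable. *)
Lemma not_positive t X m : leR X A -> ~ positive (thin t) (r X m) A.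
Proof.
move=> leXA pos.
pose state := (R * nat * (seq node * (node -> node * node)))%type.
pose Q (x : state) := leR x.1.1 A /\
  forall t, t \in x.2.1 -> positive (thin t) (r x.1.1 x.1.2) A.
pose S (n : nat) (x y : state) := [/\ r y.1.1 x.1.2 = r x.1.1 x.1.2, x.1.2 < y.1.2 &
  forall t, t \in x.2.1 -> let p := y.2.2 t in
    [/\ ext t p.1, ext t p.2, incompat p.1 p.2, p.1 \in y.2.1 & p.2 \in y.2.1]].
have [||u [u0 uQ uS]] :=
    @dependent_choice_nat state Q S ((X, m), ([:: t], fun t => (t, t))).
- by split=> // t' /=; rewrite inE => /eqP ->.
- move=> n0 [[X1 m1] [ts s0]] [/= leX1A post].
  have [X2 [m2 [s [X12 lem12 sP]]]] := split_list leX1A post.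
  have leX2A : leR X2 A by case: X12.
  (* The successor makes the lengths grow strictly, so that the points converge. *)
  exists ((X2, m2.+1), ([seq (s t).1 | t <- ts] ++ [seq (s t).2 | t <- ts], s)).
    split=> // t'; rewrite mem_cat => /orP[] /mapP[t1 ts1 ->] /=;
      have [_ _ _ p1 p2] := sP t1 ts1;
      by apply: positive_ext (basic_self m2 leX2A) _ _; rewrite ?len_r.
  split=> //=; first by case/(basic_rP ramseyR): X12.
  move=> t1 ts1; have [e1 e2 inc _ _] := sP t1 ts1; split=> //.
    by rewrite mem_cat (map_f (fun t => (s t).1) ts1).
  by rewrite mem_cat (map_f (fun t => (s t).2) ts1) orbT.
pose x n := (u n).1.1; pose mm n := (u n).1.2.
have le_mm n : n <= mm n.
  by elim: n => // n IHn; have [_ ltm _] := uS n; apply: leq_ltn_trans IHn ltm.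
have mono_mm i j : i <= j -> mm i <= mm j.
  move=> /subnKC <-; elim: (j - i) => [|d IHd]; first by rewrite addn0.
  by rewrite addnS; apply: leq_trans IHd _; have [_ /ltnW] := uS (i + d).
have coh i j : i <= j -> r (x j) (mm i) = r (x i) (mm i).
  move=> /subnKC <-; elim: (j - i) => [|d IHd]; first by rewrite addn0.
  rewrite addnS -IHd; have [e _ _] := uS (i + d).
  by apply: (r_prefix ramseyR e); apply: mono_mm; apply: leq_addr.
have [Xl eXl] : exists Xl, forall k, r Xl k = r (x k) k.
  apply: (r_limit closedR (x := fun k => r (x k) k)) => n; exists (x n) => k lekn.
  by apply: (r_prefix ramseyR (coh k n lekn)).
have eXlm n : r Xl (mm n) = r (x n) (mm n) by rewrite eXl; apply: coh.
have leXlA : leR Xl A.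
  apply/(ramsey_A2b ramseyR) => n; rewrite eXl.
  by have [/(ramsey_A2b ramseyR) leA _] := uQ n; apply: leA.
pose nodeat := fix nodeat (f : nat -> bool) n :=
  if n is n'.+1 then
    let p := (u n).2.2 (nodeat f n') in if f n' then p.1 else p.2
  else t.
have nodeat_in f n : nodeat f n \in (u n).2.1.
  elim: n => [|n IHn] /=; first by rewrite u0 inE.
  by have [_ _ /(_ _ IHn)[_ _ _ ? ?]] := uS n; case: ifP.
have step f n : ext (nodeat f n) (nodeat f n.+1) /\ lvl (nodeat f n) < lvl (nodeat f n.+1).
  have [_ _ /(_ _ (nodeat_in f n))[e1 e2 inc _ _]] := uS n.
  rewrite /=; case: ifP => _; split=> //; first exact: incompat_lvl e1 e2 inc.
  exact: incompat_lvl e2 e1 (incompat_sym inc).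
have lvl_nodeat f n : n <= lvl (nodeat f n).
  by elim: n => // n IHn; apply: leq_ltn_trans IHn (step f n).2.
have /choice[Y YP] f : exists Y, E Xl Y /\
    exists w, forall n, nodeat f n = node_of Y w (lvl (nodeat f n)).
  have [|Y [w [eY CY]]] := @positive_branch Xl (nodeat f) mm leXlA
    (fun n => (step f n).1) (lvl_nodeat f) le_mm _.
    by move=> n; rewrite eXlm; have [_] := uQ n; apply.
  by exists Y; split; [apply/EC; exists w | exists w].
have Y_inj f g : Y f = Y g -> f = g.
  move=> eY; apply/funext => n; elim/ltn_ind: n => n IHn.
  have en : nodeat f n = nodeat g n.
    have : forall i, i <= n -> nodeat f i = nodeat g i; last exact.
    by elim=> // i IHi ltin /=; rewrite IHi ?(ltnW ltin) // IHn.
  have [_ _ /(_ _ (nodeat_in f n))[_ _ inc _ _]] := uS n.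
  have [_ [wf /(_ n.+1) ef]] := YP f; have [_ [wg /(_ n.+1) eg]] := YP g.
  case efn : (f n); case egn : (g n) => //.
  - case: (inc (Y f) (Y g) wf wg) => //.
      by move: ef; rewrite /= efn.
    by move: eg; rewrite /= egn -en.
  - case: (inc (Y g) (Y f) wg wf) => //.
      by move: eg; rewrite /= egn -en.
    by move: ef; rewrite /= efn.
have /countable_injP[h h_inj] := countableE Xl.
have hY_inj f g : h (Y f) = h (Y g) -> f = g.
  by move=> /h_inj e; apply: Y_inj; apply: e; rewrite inE; case: (YP f); case: (YP g).
(* Cantor's diagonal: as [h] is injective on the points [Y f], the sequence [d] differs from every
   [f] at [h (Y f)], hence also from itself. *)
pose d n := `[< exists2 f : nat -> bool, h (Y f) = n & f n = false >].
have [dN|dN] := boolP (d (h (Y d))).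
  by have /asboolP[f /hY_inj ef fN] := dN; rewrite ef dN in fN.
have /asboolP[] := dN; exists d => //; exact: negbTE dN.
Qed.

End Split.

(** A fusion makes all nodes solved and branching. Since nothing is positive, the root is thin near
    every point, and its part is all of [E]. *)
Lemma uniformization :
  exists A, exists H : nat -> R -> R -> Prop,
    [/\ forall i, pcont (H i), forall i X Y, H i X Y -> E X Y &
      forall X Y, leR X A -> E X Y -> exists i, H i X Y].
Proof.
have [B _] := ramsey_nonempty ramseyR.
have [||A _ AP] := @fusion_depth R ramseyR closedR
  (fun i b A => forall t, node_code t = i -> solved (thin t) b A /\ branching t b A) 0 B.
- move=> i b p A1 _ _ db; have [[t et]|noT] := pselect (exists t, node_code t = i).
    have [A2 A12 sol] := solve_ideal ramseyR closedR code_inj (thin_sigma t) db.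
    have [A3 A23 br] := branching_dense t (basic_nat_depth ramseyR A12 db).
    exists A3 => [|t']; first exact: basic_nat_trans A12 A23.
    rewrite -et => /node_code_inj ->; split=> //.
    by apply: solved_le (thin_sigma t) _ sol; case/(basic_natP ramseyR): A23.
  exists A1; first exact: basic_nat_refl.
  by move=> t et; case: noT; exists t.
- move=> i b A1 A2 leA bP t et; have [sol br] := bP t et; split.
    exact: solved_le (thin_sigma t) leA sol.
  exact: branching_le leA br.
have solA t a n : node_code t <= n -> depth_is A a n -> solved (thin t) a A.
  by move=> let_ da; have [] := AP _ _ _ (leq0n n) let_ da t erefl.
have brA t a n : node_code t <= n -> depth_is A a n -> branching t a A.
  by move=> let_ da; have [] := AP _ _ _ (leq0n n) let_ da t erefl.
exists A; pose root : node := (empty_approx, [::]).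
apply: (covered_bigcup (codeT := code) (Q' := fun _ => part root) (S' := fun a => basic a A)
  (S := below A)) => // X Y leXA /EC[w CXY].
have [m [p [_ ledp dp]]] := eventually_deep 0 (node_code root) leXA.
exists (r X m); split; last 2 first.
- exact: basic_self.
- by exists w => //; rewrite /node_of /= (ramsey_A1a ramseyR).
have [//|pos] := solA _ _ _ ledp dp.
by have := not_positive solA brA leXA pos.
Qed.

End Uniformization.

(** * Separating related points *)

Section Chains.
Variable T : Type.
Implicit Types (Q : T -> T -> Prop) (x y z : T).

Fixpoint chain Q n x y : Prop :=
  if n is m.+1 then exists2 z, Q x z & chain Q m z y else x = y.

Definition clos Q x y := exists n, chain Q n x y.

Lemma chain_cat Q n m x y z : chain Q n x y -> chain Q m y z -> chain Q (n + m) x z.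
Proof.
elim: n x => [|n IHn] x /=; first by move=> ->.
by move=> [w Qxw /IHn IH] /IH; exists w.
Qed.

Lemma chain_sym Q n x y : (forall u v, Q u v -> Q v u) -> chain Q n x y -> chain Q n y x.
Proof.
move=> Qsym; elim: n x => [|n IHn] x //= [z Qxz /IHn zy].
have : chain Q (n + 1) y x by apply: chain_cat zy _; exists x => //; exact: Qsym.
by rewrite addn1.
Qed.

Lemma chain_sub Q Q' n x y : (forall u v, Q u v -> Q' u v) -> chain Q n x y -> chain Q' n x y.
Proof.
move=> QQ'; by elim: n x => [|n IHn] x //= [z /QQ' Qxz /IHn zy]; exists z.
Qed.

Lemma chain_le Q n m x y : (forall u, Q u u) -> n <= m -> chain Q n x y -> chain Q m x y.
Proof.
move=> Qrefl /subnKC <- nxy; apply: chain_cat nxy _.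
by elim: (m - n) => //= d IHd; exists y.
Qed.

Lemma clos_refl Q x : clos Q x x. Proof. by exists 0. Qed.

Lemma clos_trans Q x y z : clos Q x y -> clos Q y z -> clos Q x z.
Proof. by move=> [n nxy] [m myz]; exists (n + m); apply: chain_cat nxy myz. Qed.

Lemma clos_sym Q x y : (forall u v, Q u v -> Q v u) -> clos Q x y -> clos Q y x.
Proof. by move=> Qsym [n nxy]; exists n; apply: chain_sym. Qed.

Lemma clos_sub Q x y : Q x y -> clos Q x y.
Proof. by move=> Qxy; exists 1; exists y. Qed.

Lemma clos_min Q (S : T -> T -> Prop) x y : (forall u, S u u) ->
  (forall u v w, S u v -> S v w -> S u w) -> (forall u v, Q u v -> S u v) ->
  clos Q x y -> S x y.
Proof.
move=> Srefl Strans QS [n]; elim: n x => [|n IHn] x /=; first by move=> ->.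
by move=> [z /QS Sxz /IHn]; apply: Strans.
Qed.

End Chains.

(** Following [M] lowers the code, so every [b] starts a unique maximal path, which is finite; the
    parity of its length is the colour. In [colf] the argument [n] is recursion fuel. *)
Lemma decreasing_coloring (T : Type) (code : T -> nat) (M : T -> T -> Prop) :
  (forall b c c', M b c -> M b c' -> c = c') ->
  (forall b c, M b c -> code c < code b) ->
  exists col : T -> bool, forall b c, M b c -> col b = ~~ col c.
Proof.
move=> Mfun Mdec.
pose colf := fix colf n b := if n is m.+1 then
  (if pselect (exists c, M b c) is left e then ~~ colf m (sval (cid e)) else true) else true.
have stable n b : code b < n -> colf n b = colf (code b).+1 b.
  have : forall k n b, code b <= k -> code b < n -> colf n b = colf (code b).+1 b; last first.
    by move=> st; apply: (st (code b)).
  elim=> [|k IHk] {}n {}b lebk.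
    case: n => //= n _; case: pselect => // e; case: cid => c /= /Mdec.
    by rewrite ltnNge (leq_trans lebk).
  case: n => //= n ltbn; case: pselect => // e; case: cid => c /= /Mdec ltcb.
  have leck : code c <= k by rewrite -ltnS; apply: leq_trans lebk.
  rewrite (IHk n) //; last exact: leq_trans ltcb ltbn.
  by rewrite (IHk (code b)).
exists (fun b => colf (code b).+1 b) => b c Mbc /=.
case: pselect => [e|[]]; last by exists c.
case: cid => c' /= /(Mfun _ _ _ Mbc) <-.
by rewrite (stable (code b)) //; apply: Mdec.
Qed.

Section FinitelyManyPcont.
Variable R : approxSpace.
Hypothesis ramseyR : topological_ramsey R.
Implicit Types (X Y Z : R) (D h : R -> R -> Prop).

(** The relations contained in a finite union of [pcont] graphs; finiteness and separation pass to
    subrelations. *)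
Inductive finpcont : (R -> R -> Prop) -> Prop :=
| FinPcont h : pcont h -> finpcont h
| FinPcontSub D D' : (forall X Y, D X Y -> D' X Y) -> finpcont D' -> finpcont D
| FinPcontOr D D' : finpcont D -> finpcont D' -> finpcont (fun X Y => D X Y \/ D' X Y).

Lemma finpcont_ex n (D : nat -> R -> R -> Prop) :
  (forall i, finpcont (D i)) -> finpcont (fun X Y => exists2 i, i < n & D i X Y).
Proof.
move=> fD; elim: n => [|n IHn].
  by apply: FinPcontSub (FinPcont (@pcont_empty R)) => X Y [].
apply: FinPcontSub (FinPcontOr IHn (fD n)) => X Y [i].
rewrite ltnS leq_eqVlt => /predU1P[->|ltin] DXY; [by right | left].
by exists i.
Qed.

Lemma finpcont_comp D D' : finpcont D -> finpcont D' ->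
  finpcont (fun X Z => exists2 Y, D X Y & D' Y Z).
Proof.
move=> fD fD'; elim: fD => {D} [h ph|D1 D2 D12 _ IH|D1 D2 _ IH1 _ IH2].
- elim: fD' => {D'} [h' ph'|D1 D2 D12 _ IH|D1 D2 _ IH1 _ IH2].
  + exact/FinPcont/pcont_comp.
  + by apply: FinPcontSub IH => X Z [Y hXY /D12]; exists Y.
  + apply: FinPcontSub (FinPcontOr IH1 IH2) => X Z [Y hXY [D1Y|D2Y]]; [left|right];
      by exists Y.
- by apply: FinPcontSub IH => X Z [Y /D12]; exists Y.
- apply: FinPcontSub (FinPcontOr IH1 IH2) => X Z [Y [D1Y|D2Y]]; [left|right];
    by exists Y.
Qed.

Lemma finpcont_chain D n : finpcont D -> finpcont (chain D n).
Proof.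
by move=> fD; elim: n => [|n IHn] /=; [exact/FinPcont/pcont_id | exact: finpcont_comp].
Qed.

Lemma finpcont_finite D X : finpcont D -> finite_set [set Y | D X Y].
Proof.
move=> fD; elim: fD => {D} [h [func _ _]|D1 D2 D12 _ IH|D1 D2 _ IH1 _ IH2].
- have [[Y hXY]|noY] := pselect (exists Y, h X Y).
    by apply: sub_finite_set (finite_set1 Y) => Y' /(func _ _ _ hXY).
  by apply: sub_finite_set (finite_set0 R) => Y hXY; apply: noY; exists Y.
- by apply: sub_finite_set IH => Y /D12.
- have := conj IH1 IH2; rewrite -finite_setU; apply: sub_finite_set => Y; exact.
Qed.

Hypothesis closedR : closed (range (@approx_seq R)).
Variable code : approx R -> nat.
Hypothesis code_inj : injective code.
Local Notation len := (len ramseyR).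

Lemma len_AR a : AR_ (len a) a.
Proof. by have [n [X XR <-]] := ramsey_approx ramseyR a; exists X; rewrite ?len_r. Qed.

Lemma finite_code n : finite_set [set c : approx R | code c <= n].
Proof.
have := @finite_preimage _ _ `I_n.+1 code.
by apply; [move=> c c' _ _; exact: code_inj | exact: finite_II].
Qed.

(** It is decided on each [[b, B]] whether the image under [h] has the approximation [c], for the
    finitely many [c] of code at most that of [b]. This yields a partial map that lowers codes,
    hence a 2-colouring, and (A.4) makes the colour constant on the one-step extensions of [a]. *)
Lemma separate_pcont h a n A : pcont h -> depth_is A a n ->
  exists2 A', basic_nat n A A' &
    forall X Y, basic a A' X -> basic a A' Y -> h X Y ->
      ~ (code (r Y (len a).+1) < code (r X (len a).+1)).
Proof.
move=> ph da; pose V c := [set X | exists2 Y, h X Y & r Y (len a).+1 = c].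
have cV c : cyl_closed (V c).
  exact: (pcont_preimage ph (V := [set Y | r Y (len a).+1 = c]) (@cyl_closed_r _ _ _)).
pose dec b A c := (basic b A `<=` ~` V c) \/ forall X, basic b A X -> ~ (~` V c) X.
have dec_le b A1 A2 c : leR A2 A1 -> dec b A1 c -> dec b A2 c.
  move=> /(basic_sub ramseyR) sub [d|d]; [left|right] => X /(sub b); exact: d.
have [||B AB decB] := @fusion_depth R ramseyR closedR
  (fun _ b A => forall c, code c <= code b -> dec b A c) n A.
- move=> _ b p A1 _ _ db.
  have [||A2 A12 dec2] := @finite_shrink R ramseyR (approx R) _ p A1
      (fun c A => dec b A c) (finite_code (code b)).
  + move=> c A2 _ A12; apply: (open_ramsey ramseyR closedR code_inj (cV c)).
    exact: (basic_nat_depth ramseyR A12 db).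
  + by move=> c A2 A3 d A23; apply: dec_le d; case/(basic_natP ramseyR): A23.
  + by exists A2.
- by move=> _ b A1 A2 leA d c /d; apply: dec_le.
have da_B := basic_nat_depth ramseyR AB da.
have leBA : leR B A by case/(basic_natP ramseyR): AB.
pose M b c := [/\ code c < code b, basic b B !=set0 & forall X, basic b B X -> V c X].
have [||col colP] := @decreasing_coloring _ code M.
- move=> b c c' [_ [X bX] /(_ X bX)[Y hXY <-]] [_ _ /(_ X bX)[Y' hXY' <-]].
  by have [func _ _] := ph; rewrite (func _ _ _ hXY hXY').
- by move=> b c [].
pose O := [set c | AR_ (len a).+1 c /\ col c].
have [|A' BA' hom] := ramsey_A4 ramseyR da_B (len_AR a) (O := O); first by move=> c [].
exists A'; first exact: (basic_nat_trans ramseyR AB BA').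
move=> X Y aX aY hXY lt_code.
have leA'B : leR A' B by case/(basic_natP ramseyR): BA'.
have aXB : basic a B X by apply: basic_sub aX.
have leXB : leR X B by case: aXB.
have [p dp] := depth_exists ramseyR (len a).+1 leXB.
have lenp : n <= p.
  apply: (depth_mono ramseyR (leqnSn (len a)) _ dp).
  by case/(basicP ramseyR): aXB => _ ->.
have XbX := basic_self (len a).+1 leXB.
have [notV|inV] := decB 0 _ _ lenp isT dp _ (ltnW lt_code).
  by case: (notV X XbX); exists Y.
have /colP : M (r X (len a).+1) (r Y (len a).+1).
  by split=> // [|X' bX']; [exists X | apply: contrapT (inV X' bX')].
case: hom => [allO|noO].
  have [_ ->] := allO (r X (len a).+1) (ex_intro2 _ _ X aX erefl).
  by have [_ ->] := allO (r Y (len a).+1) (ex_intro2 _ _ Y aY erefl).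
have colN Z : basic a A' Z -> col (r Z (len a).+1) = false.
  move=> aZ; apply/negbTE/negP => colZ.
  have : ([set r C (len a).+1 | C in basic a A'] `&` O) (r Z (len a).+1).
    by split; [exists Z | split=> //; exists Z].
  by rewrite noO.
by rewrite !colN.
Qed.

Lemma separate_finpcont D a n A : finpcont D -> depth_is A a n ->
  exists2 A', basic_nat n A A' &
    forall X Y, basic a A' X -> basic a A' Y -> D X Y ->
      ~ (code (r Y (len a).+1) < code (r X (len a).+1)).
Proof.
move=> fD; elim: fD A => {D} [h ph|D1 D2 D12 _ IH|D1 D2 _ IH1 _ IH2] A da.
- exact: separate_pcont.
- by have [A' AA' sep] := IH A da; exists A' => // X Y aX aY /D12; apply: sep.
- have [A1 AA1 sep1] := IH1 A da.
  have [A2 A12 sep2] := IH2 A1 (basic_nat_depth ramseyR AA1 da).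
  exists A2; first exact: (basic_nat_trans ramseyR AA1 A12).
  have leA2 : leR A2 A1 by case/(basic_natP ramseyR): A12.
  move=> X Y aX aY [D1XY|D2XY]; last exact: sep2.
  by apply: sep1 => //; apply: (basic_sub ramseyR leA2).
Qed.

Definition separates D n A := forall X Y k, leR X A -> leR Y A -> r X k = r Y k ->
  depth_is A (r X k) n -> D X Y -> r X k.+1 = r Y k.+1.

(** [separate_finpcont] excludes only a drop of the code from [X] to [Y]; for symmetric [D] it
    applies both ways and leaves equal codes. *)
Lemma separate D n A : finpcont D -> (forall X Y, D X Y -> D Y X) ->
  exists2 A', basic_nat n A A' & separates D n A'.
Proof.
move=> fD symD.
have [||A' AA' sep] := @finite_shrink R ramseyR (approx R) _ n A
    (fun a A' => forall X Y, basic a A' X -> basic a A' Y -> D X Y ->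
      ~ (code (r Y (len a).+1) < code (r X (len a).+1))) (depth_le_finite ramseyR A n).
- by move=> a A1 da AA1; apply: separate_finpcont => //; apply: basic_nat_depth da.
- move=> a A1 A2 sep /(basic_natP ramseyR)[leA _] X Y aX aY.
  by apply: sep; apply: (basic_sub ramseyR leA).
exists A' => // X Y k leXA' leYA' eXY /(depth_basic_nat ramseyR AA') da DXY.
have aX : basic (r X k) A' X by apply: basic_self.
have aY : basic (r X k) A' Y by rewrite eXY; apply: basic_self.
apply: code_inj; apply/eqP; rewrite eqn_leq.
have := sep _ da X Y aX aY DXY; have := sep _ da Y X aY aX (symD _ _ DXY).
by rewrite len_r => /negP; rewrite -leqNgt => -> /negP; rewrite -leqNgt => ->.
Qed.

End FinitelyManyPcont.

(** * The filtration of E by finite equivalence relations *)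

Section Filtration.
Variable R : approxSpace.
Hypothesis ramseyR : topological_ramsey R.
Hypothesis closedR : closed (range (@approx_seq R)).
Local Notation AR := (approx R).
Variable code : AR -> nat.
Hypothesis code_inj : injective code.
Implicit Types (A B X Y Z : R) (a b c : AR) (n m k i : nat).

(** Unlike in [finpcont], the union is exact, since being Borel does not pass to subrelations. *)
Definition cpcont (D : R -> R -> Prop) := exists h : nat -> R -> R -> Prop,
  (forall i, pcont (h i)) /\ forall X Y, D X Y <-> exists i, h i X Y.

Lemma cpcont_pcont h : pcont h -> cpcont h.
Proof. by move=> ph; exists (fun _ => h); split=> // X Y; split=> [|[]//]; exists 0. Qed.

Lemma eq_cpcont D D' : (forall X Y, D X Y <-> D' X Y) -> cpcont D -> cpcont D'.
Proof. by move=> DD' [h [ph hP]]; exists h; split=> // X Y; rewrite -DD'. Qed.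

Lemma cpcont_ex (T : countType) (D : T -> R -> R -> Prop) : (forall t, cpcont (D t)) ->
  cpcont (fun X Y => exists t, D t X Y).
Proof.
move=> /choice[h hP].
exists (fun i => if @unpickle (T * nat)%type i is Some p then h p.1 p.2 else fun _ _ => False).
split=> [i|X Y].
  by case: unpickle => [[t j]|] /=; [have [ph _] := hP t | exact: pcont_empty].
split=> [[t /(hP t).2[j hj]]|[i]].
  by exists (pickle (t, j)); rewrite pickleK.
by case: unpickle => [[t j] /= hj|//]; exists t; apply/(hP t).2; exists j.
Qed.

Lemma cpcont_or D D' : cpcont D -> cpcont D' -> cpcont (fun X Y => D X Y \/ D' X Y).
Proof.
move=> cD cD'.
apply: (@eq_cpcont (fun X Y => exists b : bool, (if b then D else D') X Y)).
  by move=> X Y; split=> [[[]]|[]]; [left|right|exists true|exists false].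
by apply: cpcont_ex; case.
Qed.

Lemma cpcont_comp D D' : cpcont D -> cpcont D' ->
  cpcont (fun X Z => exists2 Y, D X Y & D' Y Z).
Proof.
move=> [h [ph hP]] [h' [ph' hP']].
have : cpcont (fun X Z => exists p : nat * nat, exists2 Y, h p.1 X Y & h' p.2 Y Z).
  by apply: cpcont_ex => p; apply: cpcont_pcont; apply: pcont_comp.
apply: eq_cpcont => X Z; split=> [[[i j] [Y hi hj]]|[Y /hP[i hi] /hP'[j hj]]].
  by exists Y; [apply/hP; exists i | apply/hP'; exists j].
by exists (i, j), Y.
Qed.

Lemma cpcont_clos D : cpcont D -> cpcont (clos D).
Proof.
move=> cD; apply: cpcont_ex; elim=> [|n IHn] /=; last exact: cpcont_comp.
exact: cpcont_pcont (@pcont_id R).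
Qed.

Lemma cpcont_dom D V : cyl_closed V -> cpcont D -> cpcont (fun X Y => V X /\ D X Y).
Proof.
move=> cV [h [ph hP]]; exists (fun i X Y => V X /\ h i X Y).
split=> [i|X Y]; first exact: pcont_dom.
by split=> [[VX /hP[i hi]]|[i [VX hi]]]; [exists i | split=> //; apply/hP; exists i].
Qed.

Lemma cpcont_cod D V : cyl_closed V -> cpcont D -> cpcont (fun X Y => V Y /\ D X Y).
Proof.
move=> cV [h [ph hP]]; exists (fun i X Y => h i X Y /\ V Y).
split=> [i|X Y]; first exact: pcont_cod.
by split=> [[VX /hP[i hi]]|[i [hi VX]]]; [exists i | split=> //; apply/hP; exists i].
Qed.

Variables (A0 : R) (E : R -> R -> Prop) (H : nat -> R -> R -> Prop).
Hypothesis E_refl : forall X, E X X.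
Hypothesis E_sym : forall X Y, E X Y -> E Y X.
Hypothesis E_trans : forall X Y Z, E X Y -> E Y Z -> E X Z.
Hypothesis pcontH : forall i, pcont (H i).
Hypothesis HE : forall i X Y, H i X Y -> E X Y.
Hypothesis coverH : forall X Y, leR X A0 -> E X Y -> exists i, H i X Y.

(* Requiring H q Y X as well makes this relation symmetric and locally finite. *)
Definition link n X Y := X = Y \/
  exists2 p, p < n & exists2 q, q < n & H p X Y /\ H q Y X.

Lemma link_refl n X : link n X X. Proof. by left. Qed.

Lemma link_sym n X Y : link n X Y -> link n Y X.
Proof. by case=> [->|[p ltp [q ltq []]]]; [left | right; exists q => //; exists p]. Qed.

Lemma link_le n m X Y : n <= m -> link n X Y -> link m X Y.
Proof.
move=> lenm [->|[p ltp [q ltq HpHq]]]; [by left | right].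
by exists p; [exact: leq_trans lenm | exists q => //; exact: leq_trans lenm].
Qed.

Lemma link_E n X Y : link n X Y -> E X Y.
Proof. by case=> [->//|[p _ [q _ [/HE]]]]. Qed.

Lemma finpcont_link n : finpcont (link n).
Proof.
apply: FinPcontOr; first exact/FinPcont/pcont_id.
apply: finpcont_ex => p; apply: finpcont_ex => q; apply: FinPcont; exact: pcont_inv.
Qed.

Lemma cpcont_link n : cpcont (link n).
Proof.
apply: cpcont_or; first exact/cpcont_pcont/pcont_id.
have : cpcont (fun X Y => exists p : 'I_n * 'I_n, H p.1 X Y /\ H p.2 Y X).
  by apply: cpcont_ex => p; apply: cpcont_pcont; apply: pcont_inv.
apply: eq_cpcont => X Y; split=> [[[p q] /= HpHq]|[p ltp [q ltq HpHq]]].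
  by exists p => //; exists q.
by exists (Ordinal ltp, Ordinal ltq).
Qed.

Lemma below_list : exists below_ : AR -> seq AR, forall b a, lefin a b -> a \in below_ b.
Proof.
have /choice[f fP] : forall b, exists s : seq AR, forall a, lefin a b -> a \in s.
  move=> b; have /finite_seqP[s es] := ramsey_A2a ramseyR b.
  by exists s => a ab; have : [set` s] a by rewrite -es.
by exists f.
Qed.

(** * Bounds on path lengths and the finite relations *)

Section Separated.
Variable below_ : AR -> seq AR.
Hypothesis below_P : forall b a, lefin a b -> a \in below_ b.

(** Bounds the length of link paths between points related by [filtr n]: a middle stretch of hops,
    of length [scale], and two end pieces of length [(diam A m).+1]. Only approximations of [A]
    shorter than [n] enter, so [diam A n] and [scale A n] do not change inside [[n, A]]. *)
Fixpoint diam A n := if n is m.+1 then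
  size (below_ (r A m)) * (diam A m).+2 + 2 * (diam A m).+1 else 0.

Definition scale A n := size (below_ (r A n)) * (diam A n).+2.

Lemma diamS A n : diam A n.+1 = scale A n + 2 * (diam A n).+1.
Proof. by []. Qed.

Lemma scale_basic_nat n A A' : basic_nat n A A' -> scale A' n = scale A n.
Proof.
move=> /(basic_natP ramseyR)[_ eA]; rewrite /scale eA; congr (_ * _.+2).
have : forall m, m <= n -> diam A' m = diam A m; last exact.
elim=> //= m IHm ltmn; rewrite IHm ?(ltnW ltmn) //.
by rewrite (r_prefix ramseyR eA (ltnW ltmn)).
Qed.

Lemma scale_le A n m : n <= m -> scale A n <= scale A m.
Proof.
move=> /subnKC <-; elim: (m - n) => [|d IHd]; first by rewrite addn0.
apply: leq_trans IHd _; rewrite addnS {2}/scale diamS.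
have pos : 0 < size (below_ (r A (n + d).+1)).
  have : r A (n + d).+1 \in below_ (r A (n + d).+1).
    by apply: below_P; have [refl _] := ramsey_A2 ramseyR; apply: refl.
  by case: (below_ _).
apply: leq_trans (leq_pmull _ pos); apply: leq_trans (leqnSn _).
by apply: leq_trans (leqnSn _); apply: leq_addr.
Qed.

Definition reach n L := chain (link n) L.

Lemma reach_sym n L X Y : reach n L X Y -> reach n L Y X.
Proof. by apply: chain_sym; apply: link_sym. Qed.

Lemma reach_le n m L M X Y : n <= m -> L <= M -> reach n L X Y -> reach m M X Y.
Proof.
move=> lenm leLM /(chain_le (@link_refl n) leLM).
by apply: chain_sub => U V; apply: link_le.
Qed.

(** Stage [n] of the fusion can use the length [scale A n], because the shrinking that follows no
    longer alters it. *)
Lemma separated_below : exists2 A, leR A A0 &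
  forall n, separates (reach n (scale A n)) n A.
Proof.
have [|n A A' sep AA'|A AA0 sepA] := @fusion R ramseyR closedR
    (fun n A => separates (reach n (scale A n)) n A) 0 A0.
- move=> n A _ _.
  have [||A' AA' sep] := @separate R ramseyR closedR code code_inj
    (reach n (scale A n)) n A.
  + exact/finpcont_chain/finpcont_link.
  + exact: reach_sym.
  by exists A' => //; rewrite (scale_basic_nat AA').
- have [leA _] := (basic_natP ramseyR n A A').1 AA'.
  move=> X Y k leX leY eXY dX; rewrite (scale_basic_nat AA'); apply: sep => //.
  + exact: (leR_trans ramseyR leX leA).
  + exact: (leR_trans ramseyR leY leA).
  + exact: (depth_basic_nat ramseyR AA').
by exists A => [|n]; [case/(basic_natP ramseyR): AA0 | apply: sepA].
Qed.

Variable A : R.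
Hypothesis leAA0 : leR A A0.
Hypothesis sepA : forall n, separates (reach n (scale A n)) n A.

(** By induction on the common length: longer approximations have depth at least [n], and [scale] is
    monotone, so separation at that depth still applies. *)
Lemma separated_eq n k X Y : leR X A -> leR Y A -> r X k = r Y k ->
  depth_is A (r X k) n -> reach n (scale A n) X Y -> X = Y.
Proof.
move=> leXA leYA eXY dX XY; have eXYd d : r X (k + d) = r Y (k + d).
  elim: d => [|d IHd]; first by rewrite addn0.
  have [m dm] := depth_exists ramseyR (k + d) leXA.
  have lenm := depth_mono ramseyR (leq_addr d k) dX dm.
  rewrite addnS; apply: sepA dm _ => //.
  exact: reach_le lenm (scale_le _ lenm) XY.
apply: (r_inj ramseyR) => j; apply: (r_prefix ramseyR (eXYd j)).
exact: leq_addl.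
Qed.

Definition meets n X := leR X A /\ exists k, depth_is A (r X k) n.

Definition active n X Y := [/\ leR X A, leR Y A, link n X Y & meets n X \/ meets n Y].

Fixpoint filtr n := if n is m.+1 then clos (fun X Y => filtr m X Y \/ active m X Y)
  else @eq R.

Lemma active_sym n X Y : active n X Y -> active n Y X.
Proof. by move=> [leX leY /link_sym XY [mX|mY]]; split=> //; [right|left]. Qed.

Lemma filtr_sym n X Y : filtr n X Y -> filtr n Y X.
Proof.
elim: n X Y => [|n IHn] X Y //=; apply: clos_sym => U V.
by case=> [/IHn|/active_sym]; [left|right].
Qed.

Lemma filtr_refl n X : filtr n X X.
Proof. by case: n => //= n; apply: clos_refl. Qed.

Lemma filtr_trans n X Y Z : filtr n X Y -> filtr n Y Z -> filtr n X Z.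
Proof. by case: n => [-> //|n]; apply: clos_trans. Qed.

Lemma filtr_leS n X Y : filtr n X Y -> filtr n.+1 X Y.
Proof. by move=> XY; apply: clos_sub; left. Qed.

Lemma filtr_E n X Y : filtr n X Y -> E X Y.
Proof.
elim: n X Y => [|n IHn] X Y /=; first by move=> ->.
by apply: clos_min => // U V [/IHn//|[_ _ /link_E]].
Qed.

Lemma cpcont_filtr n : cpcont (filtr n).
Proof.
elim: n => [|n IHn] /=; first exact/cpcont_pcont/pcont_id.
apply/cpcont_clos/cpcont_or => //.
have cdepth k : cyl_closed [set X | depth_is A (r X k) n].
  by move=> X /= nd; exists k => X' /= ->.
have cbelow : cyl_closed (below A) := cyl_closed_below ramseyR (A := A).
pose D (k : nat) X Y := (leR X A /\ (leR Y A /\ (depth_is A (r X k) n /\ link n X Y))) \/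
  (leR X A /\ (leR Y A /\ (depth_is A (r Y k) n /\ link n X Y))).
apply: (@eq_cpcont (fun X Y => exists k, D k X Y)) => [X Y|].
  split=> [[k [[leX [leY [d XY]]]|[leX [leY [d XY]]]]]|].
  - by split=> //; left; split=> //; exists k.
  - by split=> //; right; split=> //; exists k.
  - by move=> [leX leY XY [[_ [k d]]|[_ [k d]]]]; exists k; [left|right].
apply: cpcont_ex => k; apply: cpcont_or.
  apply: (cpcont_dom cbelow); apply: (cpcont_cod cbelow).
  by apply: (cpcont_dom (cdepth k)); apply: cpcont_link.
apply: (cpcont_dom cbelow); apply: (cpcont_cod cbelow).
by apply: (cpcont_cod (cdepth k)); apply: cpcont_link.
Qed.

(** Some [H p] and [H q] link the two points, and [X] has approximations of depth above [p] and [q],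
    at which this link is active. *)
Lemma filtr_cover X Y : leR X A -> leR Y A -> E X Y -> exists n, filtr n X Y.
Proof.
move=> leX leY EXY; have [p Hp] := coverH (leR_trans ramseyR leX leAA0) EXY.
have [q Hq] := coverH (leR_trans ramseyR leY leAA0) (E_sym EXY).
have [k kP] := depth_unbounded ramseyR (maxn p q).+1 leX.
have [n dn] := depth_exists ramseyR k leX.
have := kP k n (leqnn k) dn; rewrite gtn_max => /andP[ltpn ltqn].
exists n.+1; apply: clos_sub; right; split=> //.
  by right; exists p => //; exists q.
by left; split=> //; exists k.
Qed.

Lemma path_reach n M (e : rel R) X p : (forall U V, e U V -> reach n M U V) ->
  path e X p -> forall U V, U \in X :: p -> V \in X :: p -> reach n (size p * M) U V.
Proof.
move=> eM; elim: p X => [|Z p IHp] X /=.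
  by move=> _ U V; rewrite !inE => /eqP-> /eqP->.
move=> /andP[XZ Zp]; have IH := IHp Z Zp.
have from_X V : V \in X :: Z :: p -> reach n ((size p).+1 * M) X V.
  rewrite inE => /predU1P[->|ZV].
    exact: (chain_le (@link_refl n) (leq0n _) (erefl X : chain (link n) 0 X X)).
  by rewrite mulSn; apply: chain_cat (eM _ _ XZ) (IH _ _ _ ZV); rewrite inE eqxx.
move=> U V; rewrite inE => /predU1P[->|ZU]; first exact: from_X.
rewrite inE => /predU1P[->|ZV].
  by apply/reach_sym/from_X; rewrite inE ZU orbT.
by apply: reach_le (IH _ _ ZU ZV) => //; rewrite leq_mul2r leqnSn orbT.
Qed.

Definition hop n d X Y := [/\ meets n X, meets n Y & reach n d X Y].

(* Vertices of a simple path of hops are distinguished by their approximations of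
   depth n, of which there are boundedly many. *)
Lemma hops_reach n d X Y : d <= (diam A n).+2 -> clos (hop n d) X Y ->
  reach n (scale A n) X Y.
Proof.
move=> led [L]; pose e U V := `[< hop n d U V >].
have scale0 U : reach n (scale A n) U U.
  exact: (chain_le (@link_refl n) (leq0n _) (erefl U : chain (link n) 0 U U)).
move=> XY; have [p ep lastp] : exists2 p, path e X p & last X p = Y.
  elim: L X XY => [|L IHL] X /=; first by move=> ->; exists [::].
  by move=> [Z XZ /IHL[p Zp <-]]; exists (Z :: p) => //=; rewrite Zp andbT; apply/asboolP.
have eM U V : e U V -> reach n (diam A n).+2 U V.
  by move=> /asboolP[_ _]; apply: reach_le.
move: lastp; case: (shortenP ep) => q eq uniqq _ lastq.
have [q0|q_neq0] := eqVneq q [::]; first by move: lastq; rewrite q0 /= => <-.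
have meetq U : U \in X :: q -> meets n U.
  case: q eq {uniqq lastq} q_neq0 => // Z q; rewrite /= => /andP[/asboolP[mX mZ _] Zq] _.
  rewrite inE => /predU1P[->//|]; elim: q Z mZ Zq => [|W q IHq] Z mZ /=.
    by move=> _; rewrite inE => /eqP ->.
  move=> /andP[/asboolP[_ mW _] Wq]; rewrite inE => /predU1P[->//|]; exact: IHq.
have /choice[lab labP] (U : R) : exists k, meets n U -> depth_is A (r U k) n.
  by have [[_ [k dk]]|] := pselect (meets n U); [exists k | exists 0].
pose s := size (below_ (r A n)).
(* Separation holds only within [scale A n], so the pigeonhole argument is applied to an initial
   segment of at most [s] hops; it shows that this segment is the whole path. *)
pose t := take s q.
have tq : path e X t by apply: take_path.
have sub_t U : U \in X :: t -> U \in X :: q.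
  by rewrite !inE => /predU1P[->|/mem_take ->]; rewrite ?eqxx ?orbT.
have size_t : size t <= s by rewrite size_take; case: ltnP.
have inj_lab : {in X :: t &, injective (fun U => r U (lab U))}.
  move=> U V tU tV /= eUV; have [mU mV] := (meetq U (sub_t U tU), meetq V (sub_t V tV)).
  have elab := r_len ramseyR eUV.
  apply: (@separated_eq n (lab U)); [by case: mU | by case: mV | by rewrite eUV elab | |].
    exact: labP.
  apply: reach_le (path_reach eM tq tU tV) => //.
  by rewrite /scale leq_mul2r size_t orbT.
have : uniq [seq r U (lab U) | U <- X :: t].
  rewrite map_inj_in_uniq //; move: uniqq => /= /andP[Xq uq].
  by rewrite take_uniq // andbT; apply: contra Xq; apply: mem_take.
move=> uniq_lab; have le_s : size [seq r U (lab U) | U <- X :: t] <= s.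
  apply: (uniq_leq_size uniq_lab) => _ /mapP[U tU ->]; apply: below_P.
  by have [] := labP U (meetq U (sub_t U tU)).
rewrite size_map /= in le_s.
have et : t = q.
  apply: take_oversize; rewrite leqNgt; apply/negP => ltsq.
  by move: le_s; rewrite size_take ltsq ltnn.
rewrite -lastq; apply: reach_le (path_reach eM eq (mem_head _ _) (mem_last _ _)) => //.
by rewrite /scale leq_mul2r -et size_t orbT.
Qed.

(** Unless the path stays in a [filtr n]-class, take points [Z] and [Z'] of it that meet depth [n]
    and are near its two ends. Between them the path consists of hops, which [hops_reach] bounds
    however many there are. *)
Lemma filtr_reach n X Y : filtr n X Y -> reach n (diam A n) X Y.
Proof.
elim: n X Y => [|n IHn] X Y; first by move=> ->.
pose near U V := exists2 W, filtr n U W & link n W V.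
(* A hop is at worst a link, a stretch inside a [filtr n]-class and another link. *)
pose d := (diam A n).+2.
have near_reach U V : near U V -> reach n (diam A n).+1 U V.
  move=> [W /IHn UW WV]; rewrite -addn1; apply: chain_cat UW _; by exists V.
have near_refl U : near U U by exists U; [exact: filtr_refl | left].
have near_step U V W : filtr n U V -> near V W -> near U W.
  by move=> UV [V' VV' V'W]; exists V' => //; apply: filtr_trans UV VV'.
move=> [L XY]; suff : filtr n X Y \/ exists Z Z',
    [/\ near X Z, clos (hop n d) Z Z', near Y Z' & meets n Z].
  case=> [/IHn|[Z [Z' [/near_reach XZ ZZ' /near_reach/reach_sym Z'Y _]]]].
    apply: reach_le => //; rewrite diamS; apply: leq_trans (leq_addl _ _).
    by rewrite mul2n -addnn; apply: leq_trans (leqnSn _) (leq_addr _ _).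
  have {}ZZ' := hops_reach (leqnn _) ZZ'.
  apply: (@reach_le n _ ((diam A n).+1 + (scale A n + (diam A n).+1))) => //.
    by rewrite diamS mul2n -addnn addnCA.
  by apply: chain_cat XZ _; apply: chain_cat ZZ' _.
elim: L X XY => [|L IHL] X /=; first by move=> ->; left; apply: filtr_refl.
move=> [W [XW|XW] /IHL[WY|[Z [Z' [WZ ZZ' YZ' mZ]]]]].
- by left; apply: filtr_trans XW WY.
- by right; exists Z, Z'; split=> //; apply: near_step XW WZ.
- right; have [_ _ lXW [mX|mW]] := XW.
    exists X, X; split=> //; first exact: clos_refl.
    by exists W; [exact: filtr_sym | exact: link_sym].
  exists W, W; split=> //; [|exact: clos_refl|].
    by exists X => //; exact: filtr_refl.
  by apply: near_step (near_refl W); exact: filtr_sym.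
- right; have [_ _ lXW [mX|mW]] := XW.
    exists X, Z'; split=> //; apply: clos_trans ZZ'; apply: clos_sub; split=> //.
    by exists W => //; apply: near_reach.
  exists W, Z'; split=> //; first by exists X => //; exact: filtr_refl.
  apply: clos_trans ZZ'; apply: clos_sub; split=> //.
  by apply: reach_le (near_reach _ _ WZ).
Qed.

Lemma filtr_finite n X : finite_set [set Y | filtr n X Y].
Proof.
have := finpcont_finite X (finpcont_chain (diam A n) (finpcont_link n)).
by apply: sub_finite_set => Y /filtr_reach.
Qed.

End Separated.

Lemma finite_filtration : exists A, exists F : nat -> R -> R -> Prop,
  [/\ forall n, Equivalence (F n), forall n X Y, F n X Y -> F n.+1 X Y,
      forall n X, finite_set [set Y | F n X Y],
      forall X Y, leR X A -> leR Y A -> (E X Y <-> exists n, F n X Y) &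
      forall n, cpcont (F n)].
Proof.
have [below_ below_P] := below_list.
have [A leAA0 sepA] := separated_below below_.
exists A, (filtr A); split.
- move=> n; split=> [X|X Y|X Y Z].
  + exact: filtr_refl.
  + exact: filtr_sym.
  + exact: filtr_trans.
- exact: filtr_leS.
- by move=> n X; apply: (filtr_finite below_P sepA).
- by move=> X Y leX leY; split=> [|[n /filtr_E]//]; apply: filtr_cover.
- exact: cpcont_filtr.
Qed.

End Filtration.

(** * Borel and Suslin sets *)

Section Borel.
Variable T : topologicalType.
Implicit Types U V : set T.

Lemma borel_open U : open U -> borel U.
Proof. exact: sub_sigma_algebra. Qed.

Lemma borelC U : borel U -> borel (~` U).
Proof.
by have [_ BC _] := smallest_sigma_algebra [set: T] open => /BC; rewrite setTD.
Qed.

Lemma borel0 : borel (set0 : set T).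
Proof. by apply: borel_open; apply: open0. Qed.

Lemma borel_bigcup (I : countType) (U : I -> set T) :
  (forall i, borel (U i)) -> borel (\bigcup_i U i).
Proof.
move=> bU; have [B0 _ Bcup] := smallest_sigma_algebra [set: T] open.
pose V n := if @unpickle I n is Some i then U i else set0.
have -> : \bigcup_i U i = \bigcup_n V n.
  apply/seteqP; split=> x [].
    by move=> i _ Ux; exists (pickle i) => //; rewrite /V pickleK.
  by move=> n _; rewrite /V; case: unpickle => // i Ux; exists i.
by apply: Bcup => n; rewrite /V; case: unpickle => [i|]; [exact: bU | exact: B0].
Qed.

Lemma borelI U V : borel U -> borel V -> borel (U `&` V).
Proof.
move=> bU bV; rewrite -[U `&` V]setCK setCI; apply: borelC.
have -> : ~` U `|` ~` V = \bigcup_(b : bool) (if b then ~` U else ~` V).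
  apply/seteqP; split=> x; first by case=> ?; [exists true|exists false].
  by case=> [[]] _ ?; [left|right].
by apply: borel_bigcup => -[]; apply: borelC.
Qed.

Lemma borel_bigcap (I : countType) (U : I -> set T) :
  (forall i, borel (U i)) -> borel (\bigcap_i U i).
Proof.
move=> bU; rewrite -[X in borel X]setCK setC_bigcap; apply: borelC.
by apply: borel_bigcup => i; apply: borelC.
Qed.

Lemma borel_induction (P : set (set T)) : (forall U, open U -> P U) ->
  (forall U, P U -> P (~` U)) -> (forall U : nat -> set T, (forall i, P (U i)) ->
  P (\bigcup_i U i)) -> forall U, borel U -> P U.
Proof.
move=> Popen PC Pcup; apply: smallest_sub => //; split=> //.
- exact/Popen/open0.
- by move=> U /PC; rewrite setTD.
Qed.

End Borel.

Lemma borel_map_open (X Y : topologicalType) (f : X -> Y) :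
  (forall U, open U -> borel (f @^-1` U)) -> borel_map f.
Proof.
move=> bf; apply: borel_induction => // U; first by rewrite preimage_setC; apply: borelC.
by move=> bU; rewrite preimage_bigcup; apply: borel_bigcup.
Qed.

Lemma borel_map_set_val (X : topologicalType) (Y : set X) : borel_map (set_val : Y -> X).
Proof.
apply: borel_map_open => U oU; apply: borel_open.
by apply: open_comp oU => y _; apply: initial_continuous.
Qed.

(** An open set of the Cantor space is a union of cylinders given by finite bit sequences, of which
    there are countably many. *)
Lemma borel_map_cantor (X : topologicalType) (f : X -> cantor_space) :
  (forall n, borel [set x | f x n]) -> borel_map f.
Proof.
move=> bf; apply: borel_map_open => U oU.
pose cyl (s : seq bool) := [set y : cantor_space | forall i, i < size s -> y i = nth false s i].
have -> : f @^-1` U = \bigcup_(s : {s : seq bool | `[< cyl s `<=` U >]}) (f @^-1` (cyl (val s))).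
  apply/seteqP; split=> x /=; last by case=> -[s /= /asboolP sU] _ /sU.
  move=> Ufx; have [|n nU] := @nbhs_prod_nat _ (f x) U.
    exact: open_nbhs_nbhs.
  have [s szs sP] : exists2 s, size s = n.+1 & forall i, i < n.+1 -> f x i = nth false s i.
    by exists (mkseq (f x) n.+1) => [|i ltin]; rewrite ?size_mkseq ?nth_mkseq.
  have sU : `[< cyl s `<=` U >].
    by apply/asboolP => y ys; apply: nU => k lekn; rewrite ys ?szs // -sP.
  by exists (exist (fun s => `[< cyl s `<=` U >]) s sU) => // i; rewrite /= szs; apply: sP.
apply: borel_bigcup => -[s _] /=.
have -> : f @^-1` cyl s = \bigcap_(i : 'I_(size s)) [set x | f x i = nth false s i].
  apply/seteqP; split=> x /=; first by move=> xs i _; apply: xs.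
  by move=> xs i ltis; apply: (xs (Ordinal ltis)).
apply: borel_bigcap => i; case: (nth _ _ _); first exact: bf.
have -> : [set x | f x i = false] = ~` [set x | f x i].
  by apply/seteqP; split=> x /=; [move=> -> | move/negP/negbTE].
exact: borelC (bf _).
Qed.

(** * The metric topology and Suslin presentations of Borel sets *)

Section MetricTopology.
Variable R : approxSpace.
Hypothesis ramseyR : topological_ramsey R.
Local Notation MR := (metric_topology R).

Lemma open_approx k c : open [set X : MR | r X k = c].
Proof.
have : open ((fun y : prod_topology (fun _ : nat => discrete_topology (approx R)) => y k)
    @^-1` [set c]).
  by apply: open_comp => [y _|]; [exact: proj_continuous | exact: discrete_open].
by move=> oc; exists [set y | y k = c].
Qed.

Lemma open_cylP (V : set MR) : open V <-> cyl_open V.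
Proof.
split=> [[U oU <-] X UX|oV].
  have [|n nU] := @nbhs_prod_nat _ (approx_seq X) U; first exact: open_nbhs_nbhs.
  exists n => X' eX'; apply: nU => k lekn; exact: (r_prefix ramseyR eX').
rewrite openE => X /oV[k kV]; rewrite /interior nbhsE /=.
by exists [set X' : MR | r X' k = r X k] => [|X' /kV//]; split=> //; exact: open_approx.
Qed.

Lemma borel_cyl_closed (V : set MR) : cyl_closed V -> borel V.
Proof. by move=> /open_cylP/borel_open/borelC; rewrite setCK. Qed.

(** The points with a given approximation form a nonempty open set, so a point of the countable
    dense set together with a length names the approximation. *)
Lemma countable_approx (K : realType) : polish K MR ->
  exists code : approx R -> nat, injective code.
Proof.
move=> [[D /countable_injP[f f_inj] denseD] _].
have /choice[d dP] a : exists p : R * nat, D p.1 /\ r p.1 p.2 = a.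
  have [n [X _ <-]] := ramsey_approx ramseyR a.
  have [|Y [eY DY]] := denseD _ _ (open_approx n (r X n)); first by exists X.
  by exists (Y, n).
exists (fun a => pickle (f (d a).1, (d a).2)) => a b /(pcan_inj pickleK)[ef en].
have [Da <-] := dP a; have [Db <-] := dP b.
by rewrite en (f_inj _ _ _ _ ef) ?inE.
Qed.

Definition suslin (B : set (MR * MR)) := exists C : R -> R -> (nat -> nat) -> Prop,
  (forall X Y, B (X, Y) <-> exists w, C X Y w) /\
  forall X Y w, ~ C X Y w -> exists k, forall X' Y' w',
    r X' k = r X k -> r Y' k = r Y k -> (forall i, i < k -> w' i = w i) -> ~ C X' Y' w'.

Lemma open_prod_near (U : set (MR * MR)) X Y : open U -> U (X, Y) ->
  exists k, forall X' Y', r X' k = r X k -> r Y' k = r Y k -> U (X', Y').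
Proof.
rewrite openE => /(_ (X, Y)) /[apply] -[[P Q] /= [nP nQ] PQU].
have near (Z : MR) (W : set MR) : nbhs Z W -> exists k, forall Z', r Z' k = r Z k -> W Z'.
  rewrite nbhsE => -[V [/open_cylP oV VZ] VW]; have [k kV] := oV Z VZ.
  by exists k => Z' /kV/VW.
have [k kP] := near _ _ nP; have [l lQ] := near _ _ nQ.
exists (maxn k l) => X' Y' eX eY; apply: (PQU (X', Y')); split=> /=.
  by apply: kP; apply: (r_prefix ramseyR eX); apply: leq_maxl.
by apply: lQ; apply: (r_prefix ramseyR eY); apply: leq_maxr.
Qed.

(** The entry [w 0] is the radius of a neighbourhood inside [U], which turns the open condition into
    a projection of a closed one. *)
Lemma suslin_open U : open U -> suslin U.
Proof.
move=> oU; exists (fun X Y w => forall X' Y', r X' (w 0) = r X (w 0) ->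
  r Y' (w 0) = r Y (w 0) -> U (X', Y')).
split=> [X Y|X Y w].
  split=> [/(open_prod_near oU)[k kU]|[w wU]]; last exact: wU.
  by exists (fun _ => k).
move=> nC; exists (w 0).+1 => X' Y' w' eX eY ew C'; apply: nC => X1 Y1 e1 e2.
rewrite ew // in C'; apply: C'; first by rewrite e1 (r_prefix ramseyR eX).
by rewrite e2 (r_prefix ramseyR eY).
Qed.

Lemma suslin_closed U : open U -> suslin (~` U).
Proof.
move=> oU; exists (fun X Y _ => ~ U (X, Y)); split=> [X Y|X Y w].
  by split=> [nU|[]//]; exists (fun _ => 0).
move=> /contrapT/(open_prod_near oU)[k kU]; exists k => X' Y' w' eX eY _; apply.
exact: kU.
Qed.

Lemma suslin_bigcup (B : nat -> set (MR * MR)) : (forall i, suslin (B i)) ->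
  suslin (\bigcup_i B i).
Proof.
move=> /choice[C CP]; exists (fun X Y w => C (w 0) X Y (fun i => w i.+1)).
split=> [X Y|X Y w].
  split=> [[i _ /(CP i).1[w Cw]]|[w Cw]].
    by exists (fun j => if j is j'.+1 then w j' else i).
  by exists (w 0) => //; apply/(CP (w 0)).1; exists (fun i => w i.+1).
move=> /(CP (w 0)).2[k kP]; exists k.+1 => X' Y' w' eX eY ew.
rewrite ew //; apply: kP => [||i ltik]; last by rewrite ew.
  exact: (r_prefix ramseyR eX).
exact: (r_prefix ramseyR eY).
Qed.

Lemma suslin_bigcap (B : nat -> set (MR * MR)) : (forall i, suslin (B i)) ->
  suslin (\bigcap_i B i).
Proof.
move=> /choice[C CP].
exists (fun X Y w => forall i, C i X Y (fun j => w (pickle (i, j)))).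
split=> [X Y|X Y w].
  split=> [BXY|[w Cw] i _]; last by apply/(CP i).1; exists (fun j => w (pickle (i, j))).
  have /choice[w wP] i : exists w, C i X Y w by apply/(CP i).1; apply: BXY.
  exists (fun p => if @unpickle (nat * nat)%type p is Some q then w q.1 q.2 else 0) => i.
  by have := wP i; congr (C i X Y _); apply/funext => j; rewrite pickleK.
move=> /existsNP[i /(CP i).2[k kP]].
(* The positions below [K] include those that code the first [k] entries of the [i]-th witness. *)
pose K := maxn k (\max_(j < k) pickle (i, nat_of_ord j)).+1.
exists K => X' Y' w' eX eY ew /(_ i); apply: kP => [||j ltjk].
- by apply: (r_prefix ramseyR eX); apply: leq_maxl.
- by apply: (r_prefix ramseyR eY); apply: leq_maxl.
- apply: ew; apply: leq_trans (leq_maxr _ _); rewrite ltnS.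
  exact: (leq_bigmax (Ordinal ltjk)).
Qed.

(** Suslin sets need not be closed under complement, so the induction carries the complement
    along. *)
Lemma suslin_borel B : borel B -> suslin B.
Proof.
move=> bB; suff [] : suslin B /\ suslin (~` B) by [].
move: B bB; apply: borel_induction => [U oU|U [sU sCU]|U sU].
- by split; [exact: suslin_open | exact: suslin_closed].
- by rewrite setCK.
- split; first by apply: suslin_bigcup => i; case: (sU i).
  by rewrite setC_bigcup; apply: suslin_bigcap => i; case: (sU i).
Qed.

End MetricTopology.

(** * Reduction to E0 *)

Section Reduction.
Variable R : approxSpace.
Hypothesis ramseyR : topological_ramsey R.
Local Notation AR := (approx R).
Local Notation MR := (metric_topology R).
Variable code : AR -> nat.
Hypothesis code_inj : injective code.
Implicit Types (X Y Z : R) (n m k i j : nat).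

(* Closed under countable Boolean operations and, unlike the Borel sets in general,
   under projection along a countable union of pcont relations. *)
Definition transportable (Q : R -> Prop) := forall h, pcont h ->
  borel ([set X | exists2 Z, h X Z & Q Z] : set MR).

Lemma eq_transportable Q Q' : (forall X, Q X <-> Q' X) -> transportable Q -> transportable Q'.
Proof. by move=> QQ'; have -> : Q = Q' by apply/funext => X; apply/propext. Qed.

Lemma transportable_borel Q : transportable Q -> borel ([set X | Q X] : set MR).
Proof.
move=> /(_ _ (@pcont_id R)); congr borel; apply/seteqP.
by split=> [X [Z ->]|X QX] //; exists X.
Qed.

Lemma transportable_r k (P : AR -> Prop) : transportable (fun X => P (r X k)).
Proof.
move=> h ph; apply: (borel_cyl_closed ramseyR).
apply: (pcont_preimage ph (V := [set X | P (r X k)])).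
by move=> X /= nP; exists k => X' /= ->.
Qed.

(** As [h] is a function, the preimage of a complement is the domain, which is closed, minus a
    preimage. *)
Lemma transportable_not Q : transportable Q -> transportable (fun X => ~ Q X).
Proof.
move=> tQ h ph; have [func _ _] := ph.
have -> : [set X | exists2 Z, h X Z & ~ Q Z] =
    [set X | exists Z, h X Z] `&` ~` [set X | exists2 Z, h X Z & Q Z].
  apply/seteqP; split=> X /=.
    move=> [Z hXZ nQZ]; split; first by exists Z.
    by move=> [Z' /(func _ _ _ hXZ) <-].
  by move=> [[Z hXZ] nQ]; exists Z => // QZ; apply: nQ; exists Z.
apply: borelI; last exact: borelC (tQ h ph).
exact: (borel_cyl_closed ramseyR (pcont_closed_dom ph)).
Qed.

Lemma transportable_ex (T : countType) (Q : T -> R -> Prop) :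
  (forall t, transportable (Q t)) -> transportable (fun X => exists t, Q t X).
Proof.
move=> tQ h ph.
have -> : [set X | exists2 Z, h X Z & exists t, Q t Z] =
    \bigcup_t [set X | exists2 Z, h X Z & Q t Z].
  apply/seteqP; split=> X /=; first by move=> [Z hXZ [t QZ]]; exists t => //; exists Z.
  by move=> [t _ [Z hXZ QZ]]; exists Z => //; exists t.
by apply: borel_bigcup => t; apply: tQ.
Qed.

Lemma transportable_all (T : countType) (Q : T -> R -> Prop) :
  (forall t, transportable (Q t)) -> transportable (fun X => forall t, Q t X).
Proof.
move=> tQ; apply: (@eq_transportable (fun X => ~ exists t, ~ Q t X)) => [X|].
  by split=> [/forallNP nQ t|QX [t]]; [exact: contrapT | apply; exact: QX].
by apply: transportable_not; apply: transportable_ex => t; apply: transportable_not.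
Qed.

Lemma transportable_and Q Q' : transportable Q -> transportable Q' ->
  transportable (fun X => Q X /\ Q' X).
Proof.
move=> tQ tQ'.
apply: (@eq_transportable (fun X => forall b : bool, (if b then Q else Q') X)) => [X|].
  by split=> [QQ|[QX Q'X] []] //; split; [exact: (QQ true) | exact: (QQ false)].
by apply: transportable_all; case.
Qed.

(** Composing [h] with each piece of [D] gives a [pcont] relation again, so the projection is a
    countable union of Borel preimages. *)
Lemma transportable_cpcont D Q : cpcont D -> transportable Q ->
  transportable (fun X => exists2 Y, D X Y & Q Y).
Proof.
move=> [d [pd dP]] tQ.
apply: (@eq_transportable (fun X => exists i, exists2 Y, d i X Y & Q Y)) => [X|].
  split=> [[i [Y dXY QY]]|[Y /dP[i dXY] QY]]; last by exists i, Y.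
  by exists Y => //; apply/dP; exists i.
apply: transportable_ex => i h ph.
have := tQ _ (pcont_comp ph (pd i)); congr borel; apply/seteqP; split=> X.
  by move=> [Y [Z hXZ dZY] QY]; exists Z => //; exists Y.
by move=> [Z hXZ [Y dZY QY]]; exists Y => //; exists Z.
Qed.

Lemma finite_separation (S : set R) : finite_set S ->
  exists m, forall m' Y Z, m <= m' -> S Y -> S Z -> r Y m' = r Z m' -> Y = Z.
Proof.
move=> /finite_seqP[s ->].
have /choice[f fP] (p : R * R) : exists n, forall m, n <= m -> r p.1 m = r p.2 m -> p.1 = p.2.
  have [->|/(r_sep ramseyR)[n nP]] := pselect (p.1 = p.2); first by exists 0.
  by exists n => m /nP neq /neq.
exists (\max_(Y <- s) \max_(Z <- s) f (Y, Z)) => m Y Z lem /= sY sZ.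
apply: (fP (Y, Z)); apply: leq_trans lem.
apply: leq_trans (leq_bigmax_seq (F := fun Y => \max_(Z <- s) f (Y, Z)) Y sY isT).
exact: (leq_bigmax_seq (F := fun Z => f (Y, Z)) Z sZ isT).
Qed.

Variable F : nat -> R -> R -> Prop.
Hypothesis equivF : forall n, Equivalence (F n).
Hypothesis F_leS : forall n X Y, F n X Y -> F n.+1 X Y.
Hypothesis finF : forall n X, finite_set [set Y | F n X Y].
Hypothesis cpcontF : forall n, cpcont (F n).

Lemma F_refl n X : F n X X. Proof. by case: (equivF n). Qed.

Lemma F_sym n X Y : F n X Y -> F n Y X.
Proof. by case: (equivF n) => _ sym _; apply: sym. Qed.

Lemma F_trans n X Y Z : F n X Y -> F n Y Z -> F n X Z.
Proof. by case: (equivF n) => _ _ trans; apply: trans. Qed.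

Lemma F_le n m X Y : n <= m -> F n X Y -> F m X Y.
Proof.
move=> /subnKC <-; elim: (m - n) => [|d IHd]; first by rewrite addn0.
by rewrite addnS => /IHd/F_leS.
Qed.

Definition splits n m X := forall Y Z, F n X Y -> F n X Z -> r Y m = r Z m -> Y = Z.

Lemma splits_F n m X Y : F n X Y -> splits n m X -> splits n m Y.
Proof. by move=> XY spl U V YU YV; apply: spl; apply: F_trans XY _. Qed.

(** Transportability concerns one point at a time, so [Y] and [Z] are compared through the numbers
    in [p]: the code of [r Y m], a length, and the code of the approximation of [Y] at that length,
    from which [Z] differs. *)
Lemma transportable_splits n m : transportable (splits n m).
Proof.
apply: (@eq_transportable (fun X => ~ exists2 Y, F n X Y & exists p : nat * nat * nat,
    code (r Y m) = p.1.1 /\ (code (r Y p.1.2) = p.2 /\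
      exists2 Z, F n Y Z & code (r Z m) = p.1.1 /\ code (r Z p.1.2) <> p.2))) => [X|].
  split=> [nsp Y Z XY XZ eYZ|spl [Y XY [p [eY [eY' [Z YZ [eZ neZ]]]]]]]; last first.
    apply: neZ; rewrite -eY'; do 2 congr (_ _); congr r.
    by symmetry; apply: spl => //; [apply: F_trans XY YZ | apply: code_inj; rewrite eY].
  apply: (r_inj ramseyR) => j; apply: code_inj; apply: contrapT => neq; apply: nsp.
  exists Y => //; exists (code (r Y m), j, code (r Y j)); split=> //; split=> //=.
  exists Z; first exact: F_trans (F_sym XY) XZ.
  by split; [rewrite eYZ | apply/nesym].
apply: transportable_not; apply: transportable_cpcont => //.
apply: transportable_ex => p; apply: transportable_and.
  exact: (@transportable_r _ (fun a => code a = _)).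
apply: transportable_and; first exact: (@transportable_r _ (fun a => code a = _)).
apply: transportable_cpcont => //; apply: transportable_and.
  exact: (@transportable_r _ (fun a => code a = _)).
exact: (@transportable_r _ (fun a => code a <> _)).
Qed.

Definition split_level n m X := splits n m X /\ forall m', m' < m -> ~ splits n m' X.

(* j names the F n-class of X inside its F n.+1-class. *)
Definition class_name n j X := exists m, [/\ split_level n.+1 m X,
  exists2 Z, F n X Z & code (r Z m) = j &
  forall Z, F n X Z -> j <= code (r Z m)].

Lemma split_level_unique n m m' X Y : F n X Y ->
  split_level n m X -> split_level n m' Y -> m = m'.
Proof.
move=> XY [spl minm] [spl' minm']; apply/eqP; rewrite eqn_leq.
apply/andP; split; rewrite leqNgt; apply/negP => lt.
  exact: (minm _ lt (splits_F (F_sym XY) spl')).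
exact: (minm' _ lt (splits_F XY spl)).
Qed.

Lemma class_name_exists n X : exists j, class_name n j X.
Proof.
have [m splm minm] : exists2 m, splits n.+1 m X & forall m', splits n.+1 m' X -> m <= m'.
  apply: least_nat; have [m mP] := finite_separation (finF n.+1 X).
  by exists m => Y Z; apply: mP.
have [|j [Z XZ eZ] minj] := @least_nat (fun j => exists2 Z, F n X Z & code (r Z m) = j).
  by exists (code (r X m)), X => //; apply: F_refl.
exists j, m; split; first split=> // m' lt_m' /minm.
- by rewrite leqNgt lt_m'.
- by exists Z.
- by move=> Z' XZ'; apply: minj; exists Z'.
Qed.

Lemma class_name_unique n j j' X Y : F n X Y -> class_name n j X -> class_name n j' Y -> j = j'.
Proof.
move=> XY [m [spl [Z XZ eZ] minj]] [m' [spl' [Z' YZ' eZ'] minj']].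
have em := split_level_unique (F_leS XY) spl spl'; subst m'.
apply/eqP; rewrite eqn_leq -{1}eZ' -{2}eZ minj ?minj' //.
  exact: F_trans (F_sym XY) XZ.
exact: F_trans XY YZ'.
Qed.

Lemma class_name_inj n j X Y : F n.+1 X Y -> class_name n j X -> class_name n j Y -> F n X Y.
Proof.
move=> XY [m [spl [Z XZ eZ] _]] [m' [spl' [Z' YZ' eZ'] _]].
have em := split_level_unique XY spl spl'; subst m'.
have eZZ' : Z = Z'.
  apply: spl.1; [exact: F_leS | exact: F_trans XY (F_leS YZ') |].
  by apply: code_inj; rewrite eZ eZ'.
by rewrite -eZZ' in YZ'; apply: F_trans XZ (F_sym YZ').
Qed.

Lemma transportable_class_name n j : transportable (class_name n j).
Proof.
apply: (@eq_transportable (fun X => exists m,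
    (splits n.+1 m X /\ forall i : 'I_m, ~ splits n.+1 i X) /\
    ((exists2 Z, F n X Z & code (r Z m) = j) /\
     ~ exists2 Z, F n X Z & code (r Z m) < j))) => [X|].
  split=> [[m [[spl minm] [exj nj]]]|[m [[spl minm] exj minj]]]; exists m.
    split=> //; first by split=> // i ltim; apply: (minm (Ordinal ltim)).
    by move=> Z XZ; rewrite leqNgt; apply/negP => lt; apply: nj; exists Z.
  split; first by split=> // i; apply: minm.
  by split=> // -[Z /minj]; rewrite leqNgt => /negP.
apply: transportable_ex => m; apply: transportable_and; first apply: transportable_and.
- exact: transportable_splits.
- by apply: transportable_all => i; apply: transportable_not; apply: transportable_splits.
apply: transportable_and.
  apply: transportable_cpcont => //; exact: (@transportable_r _ (fun a => code a = _)).
apply: transportable_not; apply: transportable_cpcont => //.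
exact: (@transportable_r _ (fun a => code a < j)).
Qed.

(** The names on levels below [n] locate the [F 0]-class of [X] inside its [F n]-class. *)
Definition address n (s : seq nat) X := size s = n /\
  forall k : 'I_n, class_name k (nth 0 s k) X.

Lemma transportable_address n s : transportable (address n s).
Proof.
apply: transportable_and; first exact: (@transportable_r 0 (fun _ => size s = n)).
by apply: transportable_all => k; apply: transportable_class_name.
Qed.

Lemma address_exists n X : exists s, address n s X.
Proof.
have /choice[f fP] k := class_name_exists k X.
exists (mkseq f n); split=> [|k]; first by rewrite size_mkseq.
by rewrite nth_mkseq.
Qed.

Lemma address_unique n s s' X : address n s X -> address n s' X -> s = s'.
Proof.
move=> [sz sP] [sz' sP']; apply: (@eq_from_nth _ 0) => [|k]; first by rewrite sz sz'.
rewrite sz => ltkn; apply: class_name_unique (F_refl k X) _ _.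
  exact: (sP (Ordinal ltkn)).
exact: (sP' (Ordinal ltkn)).
Qed.

(** The name of the [F n]-class, with the address and the approximation of length [n] of one of its
    points. This depends only on the class and leaves finitely many [t]. *)
Definition feature n (t : nat * seq nat * nat) X := class_name n t.1.1 X /\
  exists2 Z, F n X Z & address n t.1.2 Z /\ code (r Z n) = t.2.

Lemma transportable_feature n t : transportable (feature n t).
Proof.
apply: transportable_and; first exact: transportable_class_name.
apply: transportable_cpcont => //; apply: transportable_and.
  exact: transportable_address.
exact: (@transportable_r _ (fun a => code a = _)).
Qed.

Lemma feature_F n t X Y : F n X Y -> feature n t X -> feature n t Y.
Proof.
move=> XY [nameX [Z XZ ftZ]]; split.
  have [j nameY] := class_name_exists n Y.
  by rewrite (class_name_unique XY nameX nameY).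
by exists Z => //; apply: F_trans (F_sym XY) XZ.
Qed.

Lemma feature_finite n X : finite_set [set t | feature n t X].
Proof.
have [j nameX] := class_name_exists n X.
have /choice[f fP] Z := address_exists n Z.
apply: sub_finite_set (finite_image (fun Z => (j, f Z, code (r Z n))) (finF n X)).
move=> [[j' s] c] [/= nameX' [Z XZ [adZ eZ]]]; exists Z => //.
rewrite eZ (address_unique (fP Z) adZ).
by rewrite (class_name_unique (F_refl n X) nameX nameX').
Qed.

(** The features give a point [Z] in the [F n]-class of [Y] with the address of [X] and
    [r Z n = r X n]. From level [N] on [X] and [Y] have equal names, so class names bring [Z] down
    into the [F N]-class of [Y]. That class is finite, so [Z] is [X] for large [n]. *)
Lemma feature_inj N X Y : (forall n t, N <= n -> feature n t X -> feature n t Y) -> F N X Y.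
Proof.
move=> XY.
have /choice[c cP] k := class_name_exists k X.
have nameY k : N <= k -> class_name k (c k) Y.
  move=> leNk; have [s adX] := address_exists k X.
  have [] // : feature k (c k, s, code (r X k)) Y.
  by apply: XY => //; split=> //; exists X => //; exact: F_refl.
have witness n : N <= n -> exists2 Z, F N Y Z & r Z n = r X n.
  move=> leNn; have [s1 adX] := address_exists n X.
  have [|_ [Z YZ [[sz adZ] /code_inj eZ]]] := XY n (c n, s1, code (r X n)) leNn.
    by split=> //; exists X => //; exact: F_refl.
  exists Z => //; have down d : d <= n - N -> F (n - d) Y Z.
    elim: d => [|d IHd] ltd; first by rewrite subn0.
    have ltdn : d < n by apply: leq_trans ltd _; apply: leq_subr.
    have eSd : (n - d.+1).+1 = n - d by rewrite subnSK.
    have ltk : n - d.+1 < n by rewrite eSd leq_subr.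
    apply: (@class_name_inj _ (c (n - d.+1))).
    - by rewrite eSd; apply: IHd; apply: ltnW.
    - by apply: nameY; rewrite leq_subRL // addnC addnS -ltn_subRL.
    - have := adZ (Ordinal ltk); have := adX.2 (Ordinal ltk) => /= nX.
      by rewrite (class_name_unique (F_refl _ X) nX (cP _)).
  by have := down _ (leqnn _); rewrite subKn.
have [m mP] : exists m, forall m' U V, m <= m' -> ([set Y' | F N Y Y'] `|` [set X]) U ->
    ([set Y' | F N Y Y'] `|` [set X]) V -> r U m' = r V m' -> U = V.
  by apply: finite_separation; rewrite finite_setU; split; [exact: finF | exact: finite_set1].
have [Z YZ eZ] := witness (maxn N m) (leq_maxl _ _).
have <- : Z = X by apply: (mP (maxn N m)) eZ; [exact: leq_maxr | left | right].
exact: F_sym.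
Qed.

Local Notation feature_index := (nat * (nat * seq nat * nat))%type.

(** The characteristic function of the set of features. With [pickle_inv] different coordinates
    stand for different features, so finitely many features affect finitely many coordinates. *)
Definition code_map X : cantor_space := fun p =>
  if @pickle_inv feature_index p is Some q then `[< feature q.1 q.2 X >]
  else false.

Lemma borel_code_map p : borel ([set X | code_map X p] : set MR).
Proof.
rewrite /code_map; case: pickle_inv => [q|].
  have -> : [set X | `[< feature q.1 q.2 X >]] = [set X | feature q.1 q.2 X].
    by apply/seteqP; split=> X /asboolP.
  by apply: transportable_borel; apply: transportable_feature.
have -> : [set X : R | false] = set0 by apply/seteqP; split.
exact: borel0.
Qed.

(** Related points share all features from some level on and have finitely many below it.
    Conversely, the coordinates below [N] involve finitely many levels, so on all higher levels the
    features agree and [feature_inj] applies. *)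
Lemma code_map_E0 X Y : (exists n, F n X Y) <-> E0 (code_map X) (code_map Y).
Proof.
split=> [[N XY]|[N XY]].
  have fin : finite_set (\bigcup_(n in `I_N) (pair n @` ([set t | feature n t X] `|`
      [set t | feature n t Y]))).
    apply: bigcup_finite; first exact: finite_II.
    by move=> n _; apply: finite_image; rewrite finite_setU; split; apply: feature_finite.
  have /finite_seqP[s sP] := finite_image (@pickle feature_index) fin.
  exists (\max_(p <- s) p).+1 => p ltsp; rewrite /code_map.
  case ep : pickle_inv => [[n t]|//] /=; have [leNn|ltnN] := leqP N n.
    by apply/asbool_equiv_eq; split; apply: feature_F; [|apply: F_sym]; apply: F_le XY.
  have nsp : p \notin s.
    apply/negP => sp; have := leq_bigmax_seq (F := id) p sp isT.
    by rewrite leqNgt ltsp.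
  have notin Z : Z = X \/ Z = Y -> ~ feature n t Z.
    move=> ZXY ft; move/negP: nsp; apply; suff : [set` s] p by [].
    rewrite -sP; exists (n, t); last by have := @pickle_invK feature_index p; rewrite ep.
    by exists n => //; exists t => //; case: ZXY => <-; [left|right].
  by rewrite !asboolF //; apply: notin; [right|left].
pose lv p := if @pickle_inv feature_index p is Some q then q.1 else 0.
exists (\max_(p < N) lv p).+1; apply: feature_inj => n t ltn.
have leNp : N <= pickle (n, t).
  rewrite leqNgt; apply/negP => ltpN.
  have := leq_bigmax (F := fun p : 'I_N => lv p) (Ordinal ltpN).
  by rewrite /lv /= pickleK_inv leqNgt ltn.
have := XY _ leNp; rewrite /code_map pickleK_inv /= => e /asboolP.
by rewrite e => /asboolP.
Qed.

End Reduction.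

Theorem theorem1p2 (K : realType) (R : approxSpace)
  (ramseyR : topological_ramsey R)
  (closedR : closed (range (@approx_seq R)))
  (polishR : polish K (metric_topology R))
  (E : metric_topology R -> metric_topology R -> Prop)
  (cberE : cber E) :
  exists A : R,
    hyperfinite (restriction E (below A : set (metric_topology R))).
Proof.
have [code code_inj] := countable_approx ramseyR polishR.
have [equivE borelE countableE] := cberE.
have [E_refl E_sym E_trans] := equivE.
have [C [CE closedC]] := suslin_borel ramseyR borelE.
have [A0 [H [pcontH HE coverH]]] :=
  uniformization ramseyR closedR code_inj CE closedC countableE.
have [A [F [equivF F_leS finF coverF cpcontF]]] :=
  finite_filtration ramseyR closedR code_inj E_refl E_sym E_trans pcontH HE coverH.
exists A, (fun X => code_map code F (\val X)); split.
  apply: borel_map_cantor => n.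
  apply: (@borel_map_set_val (metric_topology R) (below A) [set X | code_map code F X n]).
  exact: borel_code_map.
move=> X Y; rewrite -(code_map_E0 ramseyR code_inj equivF F_leS finF).
exact: (coverF _ _ (set_valP X) (set_valP Y)).
Qed.
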